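(* Let $n\ge 208$ and $p\ge 1$, and let $\mathbf{X}=\mathbf{Y}+\mathbf{E}_{\mathcal D}+\mathbf{E}_{\mathcal R}\in\mathbb{R}^{n\times p}$ follow the random contamination model described in the context. Then, with probability at least $1-2\exp(-n/297)$, for all $\mathbf B\in\mathbb{R}^{p\times p}$ and all $\boldsymbol\Theta\in\mathbb{R}^{n\times p}$, $$\big\Vert\mathbf{X}^{(n)}\mathbf B-\boldsymbol\Theta\big\Vert_{2,2}\ \ge\ \big(0.24-\|\mathbf{E}^{(n)}_{\mathcal D}\boldsymbol\Sigma_S^{\dagger/2}\|\big)\Big(\Vert\boldsymbol\Sigma_S^{1/2}\mathbf B\Vert_{2,2}\vee\Vert\boldsymbol\Theta\Vert_{2,2}\Big)-36\,\varrho(\boldsymbol\Sigma_S)\Vert\mathbf B\Vert_{1,1}\sqrt{\frac{\log p}{n}}-33\,\Vert\boldsymbol\Theta\Vert_{2,1}\sqrt{\frac{\log n}{n}}.$$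
   Context: Random contamination model: $\mathbf{X}=\mathbf{Y}+\mathbf{E}$ with $\mathbf{E}=\mathbf{E}_{\mathcal D}+\mathbf{E}_{\mathcal R}$, all in $\mathbb{R}^{n\times p}$. The matrix $\mathbf{Y}$ is random with i.i.d. $\mathcal N_p(\mathbf 0,\boldsymbol\Sigma)$ rows; $\mathbf{E}_{\mathcal D}$ is an arbitrary matrix (no distributional assumption is made on it); $\mathbf{E}_{\mathcal R}$ is a random matrix with i.i.d. $\mathcal N_p(\mathbf 0,\boldsymbol\Sigma_{\mathbf E})$ rows, independent of $\mathbf{Y}$. Here $\boldsymbol\Sigma,\boldsymbol\Sigma_{\mathbf E}\in\mathbb{R}^{p\times p}$ are covariance (symmetric positive semidefinite) matrices. If $\mathbf{E}_{\mathcal D}\ne 0$, then $\boldsymbol\Sigma$ is assumed non-singular. Notation: $\boldsymbol\Sigma_S:=\boldsymbol\Sigma+\boldsymbol\Sigma_{\mathbf E}$; $\varrho(\boldsymbol\Sigma_S):=\{\max_{j\in[p]}(\boldsymbol\Sigma_S)_{jj}\}^{1/2}$. For a matrix $\mathbf A$ with $n$ rows, $\mathbf A^{(n)}:=\mathbf A/\sqrt n$. $\|\mathbf A\|=\sigma_{\max}(\mathbf A)$ is the spectral norm. For a positive semidefinite $\mathbf A$, $\mathbf A^{\dagger/2}$ is the pseudo-inverse of $\mathbf A^{1/2}$. Mixed norms: $\Vert\mathbf A\Vert_{q_1,q_2}:=\big(\sum_i\Vert\mathbf A_{i,\bullet}\Vert_{q_1}^{q_2}\big)^{1/q_2}$,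 where $\mathbf A_{i,\bullet}$ is the $i$-th row of $\mathbf A$. $a\vee b=\max(a,b)$. *)

(* Defs.v *)
From HB Require Import structures.
From mathcomp Require Import all_boot all_order all_algebra.
From mathcomp Require Import all_classical all_reals all_analysis.

Set Implicit Arguments.
Unset Strict Implicit.
Unset Printing Implicit Defensive.

Import Order.TTheory GRing.Theory Num.Theory.
Import numFieldNormedType.Exports.

Local Open Scope classical_set_scope.
Local Open Scope ring_scope.

Section Matrices.
Context {R : realType}.

Definition psdmx (p : nat) (A : 'M[R]_p) : Prop :=
  A^T = A /\ forall u : 'cV[R]_p, 0 <= (u^T *m A *m u) 0 0.

(* A^{1/2}: the unique positive semidefinite S with S * S = A
   (meaningful only when A is positive semidefinite). *)
Definition sqrtmx (p : nat) (A : 'M[R]_p) : 'M[R]_p :=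
  xget 0 [set S | psdmx S /\ S *m S = A].

(* The unique matrix satisfying the four Penrose conditions. MathComp's pinvmx
   is only a one-sided partial inverse and does not satisfy them in general. *)
Definition mpinvmx (m n : nat) (A : 'M[R]_(m, n)) : 'M[R]_(n, m) :=
  xget 0 [set G | [/\ A *m G *m A = A, G *m A *m G = G,
                      (A *m G)^T = A *m G & (G *m A)^T = G *m A]].

Definition singular_value (m n : nat) (A : 'M[R]_(m, n)) : set R :=
  [set s | exists2 l, eigenvalue (A^T *m A) l & s = Num.sqrt l].

Definition spectral_norm (m n : nat) (A : 'M[R]_(m, n)) : R :=
  sup (singular_value A).

Definition lqnorm (q : R) (n : nat) (v : 'rV[R]_n) : R :=
  (\sum_j `|v 0 j| `^ q) `^ q^-1.

Definition mixed_norm (q1 q2 : R) (m n : nat) (A : 'M[R]_(m, n)) : R :=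
  (\sum_i lqnorm q1 (row i A) `^ q2) `^ q2^-1.

(* The diagonal entries are nonnegative for a covariance matrix, so that 0 is
   a harmless base value for the maximum. *)
Definition rho (p : nat) (S : 'M[R]_p) : R :=
  Num.sqrt (\big[Num.max/0]_(j < p) S j j).

(* A^(n) = A / sqrt n, with n the number of rows of A *)
Definition rescale (n p : nat) (A : 'M[R]_(n, p)) : 'M[R]_(n, p) :=
  (Num.sqrt n%:R)^-1 *: A.

End Matrices.

Section RandomMatrices.
Context {d : measure_display} {T : measurableType d} {R : realType}.
Variable P : probability T R.

Definition random_mx (m n : nat) (X : T -> 'M[R]_(m, n)) : Prop :=
  forall i j, measurable_fun setT (fun t => X t i j).

(* the sigma-algebra on T generated by the entries of X *)
Definition sigma_mx (m n : nat) (X : T -> 'M[R]_(m, n)) : set (set T) :=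
  <<s [set A | exists i j (B : set R), measurable B /\
                 A = (fun t => X t i j) @^-1` B] >>.

Definition indep_mx (m n m' n' : nat)
    (X : T -> 'M[R]_(m, n)) (Y : T -> 'M[R]_(m', n')) : Prop :=
  forall A B, sigma_mx X A -> sigma_mx Y B ->
    P (A `&` B) = (P A * P B)%E.

Definition mutual_indep_rows (m n : nat) (X : T -> 'M[R]_(m, n)) : Prop :=
  forall (J : {set 'I_m}) (A : 'I_m -> set T),
    (forall i, i \in J -> sigma_mx (fun t => row i (X t)) (A i)) ->
    P (\bigcap_(i in [set` J]) A i) = (\prod_(i in J) P (A i))%E.

(* N(0, v). The library's normal_prob 0 0 is a junk value (the uniform law on
   [0, 1]), hence the explicit degenerate case. *)
Definition centered_gaussian (v : R) (B : set R) : \bar R :=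
  if v == 0 then dirac (0 : R) B else normal_prob 0 (Num.sqrt v) B.

(* N_p(0, S), with S possibly singular: every linear form u of the vector
   is N(0, u^T S u). *)
Definition gaussian_vector (p : nat) (S : 'M[R]_p) (x : T -> 'rV[R]_p) : Prop :=
  random_mx x /\
  forall (u : 'cV[R]_p) (B : set R), measurable B ->
    P ((fun t => (x t *m u) 0 0) @^-1` B) =
    centered_gaussian ((u^T *m S *m u) 0 0) B.

Definition iid_gaussian_rows (n p : nat) (S : 'M[R]_p) (X : T -> 'M[R]_(n, p)) :
    Prop :=
  (forall i, gaussian_vector S (fun t => row i (X t))) /\ mutual_indep_rows X.

(* X = Y + E_D + E_R. The matrix E_D is an arbitrary function of the outcome:
   it may be deterministic, or depend on (Y, E_R) in any way. *)
Definition contamination_model (n p : nat) (Sigma SigmaE : 'M[R]_p)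
    (X Y ED ER : T -> 'M[R]_(n, p)) : Prop :=
  [/\ psdmx Sigma /\ psdmx SigmaE,
      forall t, X t = Y t + (ED t + ER t),
      iid_gaussian_rows Sigma Y /\ iid_gaussian_rows SigmaE ER,
      indep_mx Y ER &
      (exists t, ED t != 0) -> Sigma \in unitmx].

(* The event Q has probability at least c; Q itself need not be measurable
   when E_D is not. *)
Definition with_prob_ge (c : R) (Q : T -> Prop) : Prop :=
  exists A : set T,
    [/\ measurable A, (c%:E <= P A)%E & forall t, A t -> Q t].

End RandomMatrices.

(* Main.v *)
Require Import Defs.
From HB Require Import structures.
From mathcomp Require Import all_boot all_order all_algebra.
From mathcomp Require Import all_classical all_reals all_analysis.
From mathcomp Require Import measurable_realfun ring lra.

(** Put Z = Y + E_R and |b| = ||Sigma_S^(1/2) b||, and write Z^(n), E_D^(n) for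
    the matrices divided by sqrt n.

    The term in E_D is harmless.  If E_D is nonzero then Sigma, hence Sigma_S, is
    invertible, so E_D^(n) B = (E_D^(n) Sigma_S^(-1/2)) (Sigma_S^(1/2) B), and the
    spectral norm of the first factor controls the Frobenius norm of the product
    ([spectral_norm_bound]).  It remains to bound Z^(n) B - Theta from below, and
    this can be done column by column: with s = sqrt (ln p / n) and
    t = sqrt (ln n / n), one needs, for all vectors b and th,
      ||Z^(n) b - th|| >= 0.24 max(|b|, ||th||) - 36 rho ||b||_1 s - 33 ||th||_1 t,
    since the Euclidean norm over the columns gives the matrix inequality
    ([matrix_of_vector_bound]).

    The vector inequality uses no Gaussian comparison theorem: the constants leave
    enough room for a union bound over nets.  By homogeneity max(|b|, ||th||) = 1,
    and there is nothing to prove unless 36 rho ||b||_1 s and 33 ||th||_1 t are both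
    at most 0.24.  So b and th lie in fixed l1 balls (if p = 1, then s = 0 and |b| <= 1
    takes the place of the bound on ||b||_1), and Maurey's method
    ([net_point_approx]) approximates them by averages of a few signed coordinate
    vectors; these averages range over finite sets of sizes at most exp(0.06 n)
    and exp(0.18 n) that do not depend on Z ([coefficient_net], [response_net]).
    The method applies to any seminorm that is bounded on the coordinate vectors,
    so the approximation of b is good for |.| and for ||Z^(n) .|| at once, as soon
    as the columns of Z^(n) are bounded ([columns_bounded]).  That is why no
    operator norm of Z is ever estimated.

    For one fixed pair (b, th), ||Z^(n) b - th||^2 is a noncentral chi-square
    variable, and Chernoff's method shows that it falls below
    max(|b|, ||th||)^2 / 4 with probability at most exp(- n / 4) ([lower_tail]).
    As 0.06 + 0.18 - 1/4 < - 1/297, all net points behave well outside an event of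
    probability exp(- n / 297); the bound on the columns fails with at most the same
    probability.  The factor 1/2 thus obtained is larger than 0.24 by
    more than what the approximation errors cost ([vector_bound_net]).

    If s > 1/80 the net for b would be too large, but then |b| <= rho ||b||_1 < 1,
    so that ||th|| = 1 and Z^(n) b is too small to matter
    ([vector_bound_large_p]).

    The Laplace transforms needed are E exp(- l ||Z b + a||^2).  They factor over
    the rows by independence, and each factor is an explicit Gaussian integral;
    integrating over E_R first and over Y next makes it unnecessary to know the law
    of the sum ([expectation_sum_quad]). *)

Set Implicit Arguments.
Unset Strict Implicit.
Unset Printing Implicit Defensive.

Import Order.TTheory GRing.Theory Num.Theory.
Import numFieldNormedType.Exports.

Local Open Scope classical_set_scope.
Local Open Scope ring_scope.


(** * Independence and expectations of products *)

Section Independence.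
Context {d : measure_display} {T : measurableType d} {R : realType}.
Variable P : probability T R.

(** Both sides, as functions of [B], are finite measures, so they agree on the
    sigma-algebra generated by a pi-system as soon as they agree on it. *)
Lemma indep_pi_system (A : set T) (G : set (set T)) :
  measurable A -> G `<=` measurable -> setI_closed G -> G setT ->
  (forall B, G B -> P (A `&` B) = (P A * P B)%E) ->
  forall B, <<s G >> B -> P (A `&` B) = (P A * P B)%E.
Proof.
move=> mA mG GI GT AG B sGB.
have PA0 : (0 <= fine (P A))%R by rewrite fine_ge0.
pose c := NngNum PA0.
pose m1 : {measure set T -> \bar R} := mrestr P mA.
pose m2 : {measure set T -> \bar R} := mscale c P.
have cE : ((c%:num)%:E = P A)%E by rewrite /= fineK ?fin_num_measure.
have m1E X : m1 X = P (X `&` A) by [].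
have m2E X : m2 X = (P A * P X)%E by rewrite -cE.
have GE : [set X | G X /\ X `<=` [set: T]] = G.
  by apply/seteqP; split=> [X []|X GX] //; split.
have := @g_sigma_algebra_measure_unique_trace _ R T G setT measurableT.
rewrite GE => /(_ mG GI m1 m2).
have m12 X : G X -> m1 X = m2 X.
  by move=> GX; rewrite m1E m2E setIC AG.
move=> /(_ (m12 _ GT) m12).
have fT : (m1 setT < +oo)%E.
  by rewrite m1E setTI ltey_eq fin_num_measure.
move=> /(_ fT (fun X _ => @subsetT _ X) B sGB).
by rewrite m1E m2E setIC.
Qed.

Lemma measurable_fun_gsigma d' (S : measurableType d') (G : set (set T))
    (f : g_sigma_algebraType G -> S) :
  G `<=` measurable -> measurable_fun setT f ->
  measurable_fun setT (f : T -> S).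
Proof.
move=> mG mf _ B mB; rewrite setTI.
have : <<s G >> (f @^-1` B).
  by rewrite -[X in <<s G >> X]setTI; exact: mf measurableT B mB.
exact: (smallest_sub (@sigma_algebra_measurable _ T) mG).
Qed.

Lemma measurable_id_gsigma (G : set (set T)) :
  G `<=` measurable -> measurable_fun setT (id : T -> g_sigma_algebraType G).
Proof.
move=> mG _ B mB; rewrite setTI.
exact: (smallest_sub (@sigma_algebra_measurable _ T) mG).
Qed.

(** The joint law of two independent random elements is the product of their laws,
    because the two measures agree on rectangles. *)
Lemma indep_fubini d1 d2 (T1 : measurableType d1) (T2 : measurableType d2)
    (X1 : T -> T1) (X2 : T -> T2) (h : T1 * T2 -> \bar R) :
  measurable_fun setT X1 -> measurable_fun setT X2 ->
  (forall A B, measurable A -> measurable B ->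
     P (X1 @^-1` A `&` X2 @^-1` B) = (P (X1 @^-1` A) * P (X2 @^-1` B))%E) ->
  measurable_fun setT h -> (forall x, (0 <= h x)%E) ->
  (\int[P]_t h (X1 t, X2 t) = \int[P]_t \int[P]_u h (X1 t, X2 u))%E.
Proof.
move=> mX1 mX2 ind mh h0.
pose i1 : {mfun T >-> T1} := HB.pack X1 (isMeasurableFun.Build _ _ _ _ _ mX1).
pose i2 : {mfun T >-> T2} := HB.pack X2 (isMeasurableFun.Build _ _ _ _ _ mX2).
pose dg (t : T) : T1 * T2 := (X1 t, X2 t).
have mdg : measurable_fun setT dg by apply: measurable_fun_pair.
pose dgm : {mfun T >-> (T1 * T2)%type} := HB.pack dg
  (isMeasurableFun.Build _ _ _ _ _ mdg).
pose P1 : probability T1 R := distribution P i1.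
pose P2 : probability T2 R := distribution P i2.
pose P12 : {measure set (T1 * T2) -> \bar R} := distribution P dgm.
have E X : measurable X -> (P1 \x P2)%E X = P12 X.
  move=> mX; exact: product_measure_unique.
transitivity (\int[P12]_z h z)%E.
  by rewrite ge0_integral_distribution.
transitivity (\int[(P1 \x P2)%E]_z h z)%E.
  by apply: eq_measure_integral => A mA _; rewrite -E.
rewrite fubini_tonelli1 // ge0_integral_distribution //.
- apply: eq_integral => t _; rewrite /= /fubini_F ge0_integral_distribution //.
  exact: measurableT_comp.
- exact: measurable_fun_fubini_tonelli_F.
- by move=> y; apply: integral_ge0.
Qed.


Lemma sub_gsigma_measurable (G : set (set T)) :
  G `<=` measurable -> <<s G >> `<=` measurable.
Proof. by move=> mG; exact: (smallest_sub (@sigma_algebra_measurable _ T) mG). Qed.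

(** Induction on the number of factors: the first sigma-algebra is independent of
    the one generated by all the others, since the intersections of events taken
    from the latter form a pi-system to which the product rule applies. *)
Lemma expectation_prod_indep (I : finType) (G : I -> set (set T))
    (f : I -> T -> \bar R) :
  (forall i, G i `<=` measurable) ->
  (forall (J : {set I}) (A : I -> set T),
    (forall i, i \in J -> <<s G i >> (A i)) ->
    P (\bigcap_(i in [set` J]) A i) = (\prod_(i in J) P (A i))%E) ->
  (forall i, measurable_fun setT (f i : g_sigma_algebraType (G i) -> \bar R)) ->
  (forall i t, (0 <= f i t)%E) ->
  (\int[P]_t \prod_i f i t = \prod_i \int[P]_t f i t)%E.
Proof.
move=> mG ind mf f0.
suff H (s : seq I) : uniq s ->
    (\int[P]_t \prod_(i <- s) f i t = \prod_(i <- s) \int[P]_t f i t)%E.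
  by apply: H; exact: index_enum_uniq.
elim: s => [|a s IH] /=.
  move=> _; rewrite big_nil; under eq_integral do rewrite big_nil.
  by rewrite integral_cst// mul1e; apply: probability_setT.
move=> /andP[as_ us]; rewrite big_cons -IH//.
pose J := [set i in s]%SET.
(* the pi-system of all intersections of events of the remaining factors *)
pose Gs : set (set T) := [set B | exists A : I -> set T,
  (forall i, i \in J -> <<s G i >> (A i)) /\ B = \bigcap_(i in [set` J]) A i].
have sGm i := sub_gsigma_measurable (mG i).
have mGs : Gs `<=` measurable.
  move=> _ [A [hA ->]]; apply: fin_bigcap_measurable => // i iJ.
  by apply: (sGm i); apply: hA.
have sGs : <<s Gs >> `<=` measurable by exact: sub_gsigma_measurable.
have GsI : setI_closed Gs.
  move=> _ _ [A [hA ->]] [B [hB ->]]; exists (fun i => A i `&` B i); split.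
    by move=> i iJ; apply: (@measurableI _ (g_sigma_algebraType (G i)));
      [exact: hA|exact: hB].
  by rewrite bigcapI.
have sGT i : <<s G i >> setT by exact: (@measurableT _ (g_sigma_algebraType (G i))).
have GsT : Gs setT.
  by exists (fun=> setT); split => //; rewrite bigcapT.
have indA A : <<s G a >> A ->
    forall B, <<s Gs >> B -> P (A `&` B) = (P A * P B)%E.
  move=> sA; apply: indep_pi_system => //; first exact: (sGm a).
  move=> _ [B [hB ->]].
  pose C i := if i == a then A else B i.
  have aJ : a \notin J by rewrite inE.
  have CB : \bigcap_(i in [set` J]) B i = \bigcap_(i in [set` J]) C i.
    apply: eq_bigcapr => i /= iJ; rewrite /C; case: eqP => // ia.
    by move: aJ; rewrite -ia iJ.
  have hC i : i \in (a |: J)%SET -> <<s G i >> (C i).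
    rewrite /C !inE; case: eqP => [->//|_ /= iJ]; apply: hB; by rewrite inE.
  have -> : A `&` \bigcap_(i in [set` J]) B i = \bigcap_(i in [set` (a |: J)%SET]) C i.
    rewrite CB; apply/seteqP; split => t.
      move=> [At Bt] i /=; rewrite !inE => /orP[/eqP ->|iJ].
        by rewrite /C eqxx.
      by apply: Bt; rewrite /= inE.
    move=> Ct; split; first by have := Ct a; rewrite /C eqxx; apply; rewrite /= !inE eqxx.
    by move=> i /= iJ; apply: Ct; rewrite /= finset.in_setU iJ orbT.
  rewrite CB !ind//; last 1 first.
    by move=> i iJ; apply: hC; rewrite finset.in_setU iJ orbT.
  by rewrite big_setU1//= /C eqxx.
have mF : measurable_fun setT
    ((fun t => \prod_(i <- s) f i t)%E : g_sigma_algebraType Gs -> \bar R).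
  have mfs i : i \in s ->
      measurable_fun setT (f i : g_sigma_algebraType Gs -> \bar R).
    move=> is_ _ B mB; apply: sub_sigma_algebra.
    exists (fun j => if j == i then [set: T] `&` f i @^-1` B else setT); split.
      move=> j _; case: eqP => [->|_]; first exact: mf.
      exact: sGT.
    apply/seteqP; split=> [t [_ ft] j _|t /(_ i)]; first by case: eqP.
    by rewrite eqxx /= inE; apply.
  suff H s' : {subset s' <= s} -> measurable_fun setT
      ((fun t => \prod_(i <- s') f i t)%E : g_sigma_algebraType Gs -> \bar R).
    exact: H.
  elim: s' => [|b s' IHs] sub.
    by under eq_fun do rewrite big_nil; exact: measurable_cst.
  under eq_fun do rewrite big_cons.
  apply: emeasurable_funM; first by apply: mfs; exact: (sub b (mem_head _ _)).
  by apply: IHs => i is'; apply: sub; rewrite inE is' orbT.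
pose h (z : g_sigma_algebraType (G a) * g_sigma_algebraType Gs) :=
  (f a z.1 * \prod_(i <- s) f i z.2)%E.
under eq_integral do rewrite big_cons.
have F0 t : (0 <= \prod_(i <- s) f i t)%E by apply: prode_ge0.
transitivity (\int[P]_t \int[P]_u h (t, u))%E.
  rewrite -(@indep_fubini _ _ (g_sigma_algebraType (G a)) (g_sigma_algebraType Gs)
     id id h) //.
  - exact: measurable_id_gsigma.
  - exact: measurable_id_gsigma.
  - by move=> A B mA mB; apply: indA.
  - apply: emeasurable_funM.
      exact: measurableT_comp (mf a) measurable_fst.
    exact: measurableT_comp mF measurable_snd.
  - by move=> z; apply: mule_ge0.
have mFT := measurable_fun_gsigma mGs mF.
have mfT i := measurable_fun_gsigma (mG i) (mf i).
under eq_integral do rewrite /h /= ge0_integralZl//.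
rewrite ge0_integralZr//.
by apply: integral_ge0.
Qed.
End Independence.

(** * Gaussian integrals of exponentials of squares *)

Section Gaussian.
Context {R : realType}.

(** The density of the normal law is a Radon-Nikodym derivative, and such
    derivatives are almost everywhere unique. *)
Lemma ge0_integral_normal_prob (m s : R) (g : R -> \bar R) :
  measurable_fun setT g -> (forall x, (0 <= g x)%E) ->
  (\int[normal_prob m s]_x g x =
   \int[lebesgue_measure]_x (g x * (normal_pdf m s x)%:E))%E.
Proof.
move=> mg g0.
have dom := normal_prob_dominates m s.
rewrite -(Radon_Nikodym_SigmaFinite.change_of_variables dom)//.
have fint := Radon_Nikodym_SigmaFinite.f_integrable dom.
have mpdf : measurable_fun setT (fun x => (normal_pdf m s x)%:E).
  by apply/measurable_EFinP; exact: measurable_normal_pdf.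
apply: ae_eq_integral => //.
- by apply: emeasurable_funM => //; exact: measurable_int fint.
- exact: emeasurable_funM.
- apply: ae_eqe_mul2l; apply: integral_ae_eq => // E _ mE.
  by rewrite -(Radon_Nikodym_SigmaFinite.f_integral dom).
Qed.

Lemma complete_square_normal (v l a x : R) : 0 < v -> 0 < 1 + 2 * l * v ->
  expR (- l * (x + a) ^+ 2) * normal_pdf 0 (Num.sqrt v) x =
  (Num.sqrt (1 + 2 * l * v))^-1 * expR (- l * a ^+ 2 / (1 + 2 * l * v)) *
  normal_pdf (- (2 * l * v * a) / (1 + 2 * l * v))
             (Num.sqrt (v / (1 + 2 * l * v))) x.
Proof.
move=> v0 k0; set k := 1 + _ in k0 *.
have w0 : 0 < v / k by rewrite divr_gt0.
rewrite !normal_pdfE ?gt_eqF ?sqrtr_gt0//.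
rewrite /normal_peak /normal_fun !sqr_sqrtr ?ltW//.
move: (pi : R) (@pi_gt0 R) => q q0.
have -> : Num.sqrt (v * q *+ 2) = Num.sqrt k * Num.sqrt (v / k * q *+ 2).
  rewrite -sqrtrM ?ltW//; congr Num.sqrt; rewrite -(mulr_natr (v * q)).
  rewrite -(mulr_natr (v / k * q)).
  by field; rewrite gt_eqF.
set s := Num.sqrt (v / k * q *+ 2).
rewrite [LHS]mulrCA -expRD invfM -!mulrA; congr (_ * _).
rewrite [RHS]mulrCA; congr (_ * _); rewrite -expRD; congr expR.
rewrite -(mulr_natr v) -(mulr_natr (v / k)) subr0.
by rewrite /k; field; rewrite !gt_eqF.
Qed.

(** Negative [l] is allowed: the upper tail of a chi-square variable needs it. *)
Lemma expectation_gaussian_quad (d : measure_display) (T : measurableType d)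
    (P : probability T R) (V : T -> R) (v l a : R) :
  measurable_fun setT V ->
  (forall B, measurable B -> P (V @^-1` B) = centered_gaussian v B) ->
  0 <= v -> 0 < 1 + 2 * l * v ->
  (\int[P]_t (expR (- l * (V t + a) ^+ 2))%:E =
   ((Num.sqrt (1 + 2 * l * v))^-1 * expR (- l * a ^+ 2 / (1 + 2 * l * v)))%:E)%E.
Proof.
move=> mV hV v0 k0.
have mV' : measurable_fun setT (V : T -> measurableTypeR R) by exact: mV.
pose X : {mfun T >-> measurableTypeR R} :=
  HB.pack (V : T -> measurableTypeR R) (isMeasurableFun.Build _ _ _ _ _ mV').
pose g (x : measurableTypeR R) := (expR (- l * (x + a) ^+ 2))%:E.
have mg : measurable_fun setT g.
  apply/measurable_EFinP; apply: measurableT_comp => //.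
  apply: measurable_funM => //; apply: measurable_funX.
  by apply: measurable_funD.
have g0 x : (0 <= g x)%E by rewrite lee_fin expR_ge0.
transitivity (\int[distribution P X]_x g x)%E.
  by rewrite ge0_integral_distribution.
have [vE|vn0] := eqVneq v 0.
  transitivity (\int[dirac (0%R : measurableTypeR R)]_x g x)%E.
    apply: eq_measure_integral => A mA _.
    by have := hV A mA; rewrite /centered_gaussian vE eqxx.
  rewrite integral_dirac// diracT mul1e /g vE.
  by rewrite mulr0 addr0 sqrtr1 invr1 mul1r add0r mulr1.
have vp : 0 < v by rewrite lt_def vn0.
transitivity (\int[normal_prob 0%R (Num.sqrt v)]_x g x)%E.
  apply: eq_measure_integral => A mA _.
  by have := hV A mA; rewrite /centered_gaussian (negbTE vn0).
rewrite ge0_integral_normal_prob//.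
under eq_integral do rewrite /g -EFinM complete_square_normal// EFinM.
rewrite ge0_integralZl//.
- by rewrite integral_normal_pdf mule1.
- by apply/measurable_EFinP; exact: measurable_normal_pdf.
- by move=> x _; rewrite lee_fin normal_pdf_ge0.
Qed.
End Gaussian.

(** * Laplace transform of the squared norm *)

Section Moments.
Context {d : measure_display} {T : measurableType d} {R : realType}.
Variable P : probability T R.

(** The generating sets of [sigma_mx X]; naming them lets [sigma_mx X] be used as
    the sigma-algebra of the type [g_sigma_algebraType (gen_mx X)]. *)
Definition gen_mx (m n : nat) (X : T -> 'M[R]_(m, n)) : set (set T) :=
  [set A | exists i j (B : set R), measurable B /\
                 A = (fun t => X t i j) @^-1` B].

Lemma gen_mx_measurable (m n : nat) (X : T -> 'M[R]_(m, n)) :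
  random_mx X -> gen_mx X `<=` measurable.
Proof.
move=> mX _ [i [j [B [mB ->]]]]; rewrite -[X in measurable X]setTI.
exact: mX.
Qed.

Lemma measurable_mulmx_gen (m n : nat) (X : T -> 'M[R]_(m, n)) (b : 'cV[R]_n) i :
  measurable_fun setT
    ((fun t => (X t *m b) i 0) : g_sigma_algebraType (gen_mx X) -> R).
Proof.
under eq_fun do rewrite mxE.
apply: measurable_sum => j; apply: measurable_funM => // _ B mB.
by rewrite setTI; apply: sub_sigma_algebra; exists i, j, B.
Qed.

Lemma gaussian_rows_random (n p : nat) (S : 'M[R]_p) (X : T -> 'M[R]_(n, p)) :
  iid_gaussian_rows P S X -> random_mx X.
Proof.
move=> [gX _] i j; have [/(_ 0 j) + _] := gX i.
by under eq_fun do rewrite mxE.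
Qed.

Lemma expectation_rows_quad (n p : nat) (S : 'M[R]_p) (X : T -> 'M[R]_(n, p))
    (b : 'cV[R]_p) (a : 'I_n -> R) (l : R) :
  iid_gaussian_rows P S X ->
  let v := (b^T *m S *m b) 0 0 in
  0 <= v -> 0 < 1 + 2 * l * v ->
  (\int[P]_t (expR (- l * \sum_i ((X t *m b) i 0 + a i) ^+ 2))%:E =
   ((Num.sqrt (1 + 2 * l * v))^-1 ^+ n *
     expR (- l * (\sum_i a i ^+ 2) / (1 + 2 * l * v)))%:E)%E.
Proof.
move=> gX v v0 k0; have mX := gaussian_rows_random gX.
have [gr ind] := gX.
pose V i t := (X t *m b) i 0.
have VE i t : V i t = (row i (X t) *m b) 0 0.
  by rewrite -row_mul mxE.
pose f i t := (expR (- l * (V i t + a i) ^+ 2))%:E : \bar R.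
transitivity (\int[P]_t \prod_i f i t)%E.
  apply: eq_integral => t _; rewrite mulr_sumr expR_sum.
  by rewrite -prodEFin.
have mrow i : random_mx (fun t => row i (X t)) by have [] := gr i.
have mq (c : R) : measurable_fun setT (fun x : R => (expR (- l * (x + c) ^+ 2))%:E).
  apply/measurable_EFinP; apply: measurableT_comp => //.
  apply: measurable_funM => //; apply: measurable_funX.
  by apply: measurable_funD.
have fE i : (\int[P]_t f i t = ((Num.sqrt (1 + 2 * l * v))^-1 *
    expR (- l * a i ^+ 2 / (1 + 2 * l * v)))%:E)%E.
  apply: expectation_gaussian_quad => //.
    apply: (measurable_fun_gsigma (gen_mx_measurable mX)).
    exact: measurable_mulmx_gen.
  move=> B mB; have [_ <-//] := gr i.
  rewrite (_ : V i = (fun t => (row i (X t) *m b) 0 0)) //.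
  by apply/funext => t; exact: VE.
rewrite (@expectation_prod_indep _ _ _ P _ (fun i => gen_mx (fun t => row i (X t)))).
- rewrite (eq_bigr _ (fun i _ => fE i)) prodEFin; congr EFin.
  rewrite big_split /= prodr_const card_ord -expR_sum.
  by rewrite mulr_sumr mulr_suml.
- by move=> i; exact: gen_mx_measurable.
- by move=> J A hA; exact: ind.
- move=> i; pose r t := (row i (X t) *m b) 0 0.
  rewrite (_ : f i = (fun x : R => (expR (- l * (x + a i) ^+ 2))%:E) \o r).
    apply: (measurableT_comp (mq (a i))).
    exact: (@measurable_mulmx_gen _ _ (fun t => row i (X t)) b 0).
  by apply/funext => t; rewrite /f VE.
- by move=> i t; rewrite lee_fin expR_ge0.
Qed.

(** Given [Y], the expectation over [E] has the shape exp(- l' ||Y b + a||^2) with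
    l' = l / (1 + 2 l v2), where v2 is the variance of a row of [E b]; it can thus be
    integrated over [Y] by the same formula, and
    (1 + 2 l v2) (1 + 2 l' v1) = 1 + 2 l (v1 + v2). *)
Lemma expectation_sum_quad (n p : nat) (S1 S2 : 'M[R]_p)
    (Y E : T -> 'M[R]_(n, p)) (b : 'cV[R]_p) (a : 'I_n -> R) (l : R) :
  iid_gaussian_rows P S1 Y -> iid_gaussian_rows P S2 E -> indep_mx P Y E ->
  psdmx S1 -> psdmx S2 ->
  let v := (b^T *m (S1 + S2) *m b) 0 0 in
  0 < 1 + 2 * l * v ->
  (\int[P]_t (expR (- l * \sum_i (((Y t + E t) *m b) i 0 + a i) ^+ 2))%:E =
   ((Num.sqrt (1 + 2 * l * v))^-1 ^+ n *
     expR (- l * (\sum_i a i ^+ 2) / (1 + 2 * l * v)))%:E)%E.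
Proof.
move=> gY gE ind psd1 psd2 v k0.
have mY := gen_mx_measurable (gaussian_rows_random gY).
have mE := gen_mx_measurable (gaussian_rows_random gE).
pose v1 := (b^T *m S1 *m b) 0 0; pose v2 := (b^T *m S2 *m b) 0 0.
have v10 : 0 <= v1 by apply: psd1.2.
have v20 : 0 <= v2 by apply: psd2.2.
have vE : v = v1 + v2 by rewrite /v mulmxDr mulmxDl mxE.
have k20 : 0 < 1 + 2 * l * v2.
  case: (lerP 0 l) => l0; first by rewrite ltr_pwDl// !mulr_ge0.
  by apply: lt_le_trans k0 _; rewrite vE; nra.
pose h (z : g_sigma_algebraType (gen_mx Y) * g_sigma_algebraType (gen_mx E)) :=
  (expR (- l * \sum_i ((E z.2 *m b) i 0 + ((Y z.1 *m b) i 0 + a i)) ^+ 2))%:E : \bar R.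
transitivity (\int[P]_t h (t, t))%E.
  apply: eq_integral => t _; rewrite /h /=; do 3 congr (_ _).
  by apply: eq_bigr => i _; rewrite mulmxDl mxE addrA (addrC ((E t *m b) _ _)).
rewrite (@indep_fubini _ _ _ P _ _ (g_sigma_algebraType (gen_mx Y))
   (g_sigma_algebraType (gen_mx E)) id id h); first last.
- by move=> z; rewrite lee_fin expR_ge0.
- apply/measurable_EFinP; apply: measurableT_comp => //.
  apply: measurable_funM => //; apply: measurable_sum => i; apply: measurable_funX.
  apply: measurable_funD.
    exact: measurableT_comp (@measurable_mulmx_gen _ _ E b i) measurable_snd.
  apply: measurable_funD => //.
  exact: measurableT_comp (@measurable_mulmx_gen _ _ Y b i) measurable_fst.
- by move=> A B mA mB; exact: ind.
- exact: measurable_id_gsigma.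
- exact: measurable_id_gsigma.
under eq_integral do rewrite /h /= (expectation_rows_quad _ gE v20 k20) EFinM.
have k1 : 1 + 2 * (l / (1 + 2 * l * v2)) * v1 = (1 + 2 * l * v) / (1 + 2 * l * v2).
  by rewrite vE; field; rewrite gt_eqF.
have k10 : 0 < 1 + 2 * (l / (1 + 2 * l * v2)) * v1 by rewrite k1 divr_gt0.
rewrite ge0_integralZl//; first last.
- apply/measurable_EFinP; apply: (measurable_fun_gsigma mY).
  apply: measurableT_comp => //.
  apply: measurable_funM => //; apply: measurable_funM => //.
  apply: measurable_sum => i; apply: measurable_funX; apply: measurable_funD => //.
  exact: measurable_mulmx_gen.
have := expectation_rows_quad a gY v10 k10.
under eq_integral do rewrite mulrAC mulNr.
move=> ->; rewrite -EFinM; congr EFin; rewrite [LHS]mulrA.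
rewrite -exprMn k1; congr (_ ^+ _ * expR _).
  by rewrite -invfM -sqrtrM 1?ltW// mulrC divfK// gt_eqF.
by field; rewrite !gt_eqF.
Qed.
End Moments.

(** * Tail bounds *)

Section ExpBounds.
Context {R : realType}.

Lemma expR1_le3 : expR 1 <= 3 :> R.
Proof.
have h : (9 / 10) ^+ 10 <= expR (- 1) :> R.
  have -> : -1 = - (1 / 10) * 10%:R :> R by field.
  rewrite expRM_natr.
  (* e^-1 >= (1 - 1/10)^10, which exceeds 1/3 *)
  have h9 : 9 / 10 <= expR (- (1 / 10)) :> R.
    by apply: le_trans (expR_ge1Dx _); lra.
  by apply: lerXn2r; rewrite ?nnegrE ?expR_ge0//; lra.
rewrite -[1]opprK expRN -[leRHS]invrK lef_pV2 ?posrE ?expR_gt0 ?invr_gt0//.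
by apply: le_trans h; lra.
Qed.

Lemma expR1_ge2 : 2 <= expR 1 :> R.
Proof. by apply: le_trans (expR_ge1Dx _); lra. Qed.

Lemma expR_half_sqr : (expR (1 / 2)) ^+ 2 = expR 1 :> R.
Proof. by rewrite -expRM_natr; congr expR; field. Qed.

(** This is the contribution of one coordinate to the Laplace transform in
    [lower_tail], where x and y are the squares of |b| and ||a|| / sqrt n relative
    to the larger one.  If x = 1 the claim follows from e <= 3; if y = 1, from
    ln w >= 1 - 1 / w with w = 1 + 2 x. *)
Lemma lower_tail_factor (x y : R) : 0 <= x -> 0 <= y -> x <= 1 -> y <= 1 ->
  x = 1 \/ y = 1 ->
  (Num.sqrt (1 + 2 * x))^-1 * expR (- y / (1 + 2 * x)) <= expR (- (1 / 2)).
Proof.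
move=> x0 y0 x1 y1 xy; set w := 1 + 2 * x.
have w1 : 1 <= w by rewrite /w; lra.
have w0 : 0 < w by lra.
have sw : 0 < Num.sqrt w by rewrite sqrtr_gt0.
rewrite mulNr !expRN -invfM lef_pV2 ?posrE ?mulr_gt0 ?expR_gt0//.
rewrite -(@ler_pXn2r _ 2) ?nnegrE ?mulr_ge0 ?expR_ge0 ?(ltW sw)//.
rewrite expR_half_sqr exprMn sqr_sqrtr ?(ltW w0)// -expRM_natr.
case: xy => [xE|yE].
  have -> : w = 3 by rewrite /w xE; lra.
  apply: le_trans expR1_le3 _; rewrite ler_peMr// -[leLHS]expR0 ler_expR.
  by rewrite !mulr_ge0//; lra.
rewrite yE.
have -> : expR 1 = expR (1 - 1 / w) * expR (- (1 / w)) * expR (1 / w * 2) :> R.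
  by rewrite -!expRD; congr expR; ring.
rewrite ler_pM2r ?expR_gt0//.
have h1 : expR (1 - 1 / w) * expR (- (1 / w)) <= w.
  have : expR (- (1 - 1 / w)) >= 1 / w by apply: le_trans (expR_ge1Dx _); lra.
  have wi : 0 < 1 / w by rewrite divr_gt0.
  rewrite expRN => h; have : expR (1 - 1 / w) <= w.
    rewrite -[leRHS]invrK -[leLHS]invrK lef_pV2 ?posrE ?invr_gt0 ?expR_gt0//.
    by move: h; rewrite !mul1r.
  move=> hA; apply: le_trans hA; rewrite ler_piMr ?expR_ge0// -[leRHS]expR0 ler_expR; lra.
exact: h1.
Qed.

Lemma upper_tail_factor (w : R) : 1 / 2 <= w -> (Num.sqrt w)^-1 <= expR (1 / 2).
Proof.
move=> w2; have w0 : 0 < w by lra.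
rewrite -(@ler_pXn2r _ 2) ?nnegrE ?expR_ge0 ?invr_ge0 ?sqrtr_ge0//.
rewrite exprVn sqr_sqrtr ?(ltW w0)// expR_half_sqr.
apply: le_trans expR1_ge2; rewrite -[leRHS]invrK lef_pV2 ?posrE ?invr_gt0//; lra.
Qed.
End ExpBounds.

Section Tails.
Context {d : measure_display} {T : measurableType d} {R : realType}.
Variable P : probability T R.

Lemma exp_markov (g : T -> R) (c K : R) :
  measurable_fun setT g ->
  (\int[P]_t (expR (g t))%:E <= K%:E)%E ->
  (P [set t | (c <= g t)%R] <= (K * expR (- c))%:E)%E.
Proof.
move=> mg hK.
pose X : {RV P >-> R} := HB.pack g (isMeasurableFun.Build _ _ _ _ _ mg).
have := @chernoff _ T R P X 1 c ltr01.
rewrite mul1r => /le_trans; apply; rewrite EFinM.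
apply: lee_wpmul2r; first by rewrite lee_fin expR_ge0.
apply: le_trans hK; rewrite /mmt_gen_fun unlock.
rewrite le_eqVlt; apply/orP; left; apply/eqP; apply: eq_integral => t _ /=.
by rewrite mulr1.
Qed.

Lemma union_bound (I : finType) (A : I -> set T) (c : R) :
  (forall i, measurable (A i)) -> (forall i, (P (A i) <= c%:E)%E) ->
  measurable (\bigcup_(i in [set: I]) A i) /\
  (P (\bigcup_(i in [set: I]) A i) <= (#|I|%:R * c)%:E)%E.
Proof.
move=> mA hA; have E : \bigcup_(i in [set: I]) A i = \big[setU/set0]_i A i.
  rewrite -bigcup_seq; apply: eq_bigcupl; split=> i //= _.
  by rewrite mem_index_enum.
rewrite E; split; first by apply: bigsetU_measurable.
have H (s : seq I) : (P (\big[setU/set0]_(i <- s) A i) <= (\sum_(i <- s) c)%:E)%E.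
  elim: s => [|i s IH]; first by rewrite !big_nil measure0.
  rewrite !big_cons EFinD; apply: le_trans (leeD (hA i) IH).
  apply: measureU2 => //; exact: bigsetU_measurable.
by apply: le_trans (H _) _; rewrite sumr_const cardT mulr_natl -cardT.
Qed.

Variables (n p : nat) (S1 S2 : 'M[R]_p) (Y E : T -> 'M[R]_(n, p)).
Hypotheses (gY : iid_gaussian_rows P S1 Y) (gE : iid_gaussian_rows P S2 E).
Hypotheses (ind : indep_mx P Y E) (psd1 : psdmx S1) (psd2 : psdmx S2).
Let S := S1 + S2.

Lemma measurable_mulmx_sum (b : 'cV[R]_p) i :
  measurable_fun setT (fun t => ((Y t + E t) *m b) i 0).
Proof.
under eq_fun do rewrite mulmxDl mxE.
have mY := gen_mx_measurable (gaussian_rows_random gY).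
have mE := gen_mx_measurable (gaussian_rows_random gE).
apply: measurable_funD;
  [apply: (measurable_fun_gsigma mY)|apply: (measurable_fun_gsigma mE)];
  exact: measurable_mulmx_gen.
Qed.

Lemma measurable_sum_sqr (b : 'cV[R]_p) (a : 'I_n -> R) :
  measurable_fun setT (fun t => \sum_i (((Y t + E t) *m b) i 0 + a i) ^+ 2).
Proof.
apply: measurable_sum => i; apply: measurable_funX; apply: measurable_funD => //.
exact: measurable_mulmx_sum.
Qed.

(** Chernoff's method with parameter 1 / M.  The Laplace transform is at most
    exp(- n / 2), and the threshold n M / 4 costs a factor exp(n / 4). *)
Lemma lower_tail (b : 'cV[R]_p) (a : 'I_n -> R) (M : R) :
  let v := (b^T *m S *m b) 0 0 in
  (0 < n)%N -> 0 < M -> v <= M -> \sum_i a i ^+ 2 <= n%:R * M ->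
  v = M \/ \sum_i a i ^+ 2 = n%:R * M ->
  (P [set t | (\sum_i (((Y t + E t) *m b) i 0 + a i) ^+ 2 <= n%:R * M / 4)%R]
    <= (expR (- (n%:R / 4)))%:E)%E.
Proof.
move=> v n0 M0 vM aM vaM.
have v0 : 0 <= v by rewrite /v mulmxDr mulmxDl mxE addr_ge0 ?psd1.2 ?psd2.2.
have k0 : 0 < 1 + 2 * M^-1 * v by rewrite ltr_pwDl// !mulr_ge0// invr_ge0 ltW.
have := expectation_sum_quad a gY gE ind psd1 psd2 k0.
rewrite -/S -/v => eqE.
pose g t := - M^-1 * \sum_i (((Y t + E t) *m b) i 0 + a i) ^+ 2.
have mg : measurable_fun setT g by apply: measurable_funM => //; exact: measurable_sum_sqr.
have -> : [set t | (\sum_i (((Y t + E t) *m b) i 0 + a i) ^+ 2 <= n%:R * M / 4)%R]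
   = [set t | - (n%:R / 4) <= g t].
  apply: eq_set => t.
  by rewrite /g mulNr lerN2 [M^-1 * _]mulrC ler_pdivrMr// mulrAC.
apply: le_trans (@exp_markov g _ (expR (- (n%:R / 2))) mg _) _; last first.
  rewrite -expRD lee_fin ler_expR; lra.
rewrite eqE lee_fin.
have nR : 0 < n%:R :> R by rewrite ltr0n.
pose y := (\sum_i a i ^+ 2) / (n%:R * M).
have -> : - M^-1 * (\sum_i a i ^+ 2) / (1 + 2 * M^-1 * v)
   = (- y / (1 + 2 * (v / M))) * n%:R.
  rewrite /y mulrC -[2 * M^-1 * v]mulrA [M^-1 * v]mulrC; field.
  apply/and3P; split; rewrite gt_eqF// ltr_pwDl ?mulr_ge0//.
rewrite expRM_natr -exprMn.
have -> : expR (- (n%:R / 2)) = expR (- (1/2)) ^+ n :> R.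
  by rewrite -expRM_natr; congr expR; ring.
rewrite -[2 * M^-1 * v]mulrA [M^-1 * v]mulrC.
apply: lerXn2r; rewrite ?nnegrE ?mulr_ge0 ?invr_ge0 ?sqrtr_ge0 ?expR_ge0//.
apply: lower_tail_factor.
- by rewrite divr_ge0// ltW.
- by rewrite divr_ge0 ?mulr_ge0 ?sumr_ge0// ?(ltW M0)// => i _; rewrite sqr_ge0.
- by rewrite ler_pdivrMr// mul1r.
- by rewrite ler_pdivrMr ?mulr_gt0// mul1r.
- case: vaM => h; [left; rewrite h|right; rewrite /y h];
  by rewrite divff// gt_eqF// mulr_gt0.
Qed.

(** Chernoff's method with parameter 1 / (4 r), for which the Laplace transform is
    at most 2^(n/2) <= exp(n / 2).  The term 4 c r of the threshold buys a factor
    exp(- c), meant to pay for a union bound over the columns. *)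
Lemma upper_tail (b : 'cV[R]_p) (r c : R) :
  let v := (b^T *m S *m b) 0 0 in
  0 < r -> v <= r ->
  (P [set t | (n%:R * (3 * r) + 4 * c * r <= \sum_i (((Y t + E t) *m b) i 0) ^+ 2)%R]
    <= (expR (- (n%:R / 4) - c))%:E)%E.
Proof.
move=> v r0 vr.
have v0 : 0 <= v by rewrite /v mulmxDr mulmxDl mxE addr_ge0 ?psd1.2 ?psd2.2.
pose l := - (4 * r)^-1.
have vr' : v / r <= 1 by rewrite ler_pdivrMr// mul1r.
have kE : 1 + 2 * l * v = 1 - v / r / 2 by rewrite /l; field; rewrite gt_eqF.
have k2 : 1 / 2 <= 1 + 2 * l * v by rewrite kE; lra.
have k0 : 0 < 1 + 2 * l * v by lra.
have := expectation_sum_quad (fun=> 0) gY gE ind psd1 psd2 k0.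
rewrite -/S -/v => eqE.
pose g t := - l * \sum_i (((Y t + E t) *m b) i 0 + 0) ^+ 2.
have mg : measurable_fun setT g by apply: measurable_funM => //; exact: measurable_sum_sqr.
have -> : [set t | (n%:R * (3 * r) + 4 * c * r <= \sum_i (((Y t + E t) *m b) i 0) ^+ 2)%R]
   = [set t | n%:R * (3 / 4) + c <= g t].
  apply: eq_set => t; rewrite /g /l opprK ler_pdivlMl ?mulr_gt0//.
  under [in RHS]eq_bigr do rewrite addr0.
  by congr (is_true (_ <= _)); field.
apply: le_trans (@exp_markov g _ (expR (n%:R / 2)) mg _) _; last first.
  rewrite -expRD lee_fin ler_expR; lra.
rewrite eqE lee_fin big1; last by move=> i _; rewrite expr0n.
rewrite mulr0 mul0r expR0 mulr1.
have -> : expR (n%:R / 2) = expR (1/2) ^+ n :> R.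
  by rewrite -expRM_natr; congr expR; ring.
by apply: lerXn2r; rewrite ?nnegrE ?expR_ge0 ?invr_ge0 ?sqrtr_ge0// upper_tail_factor.
Qed.

(** A centred Gaussian variable of variance 0 vanishes almost surely.  The Chernoff
    bound of [upper_tail] does not cover this case, which occurs if the diagonal of
    the covariance matrix is zero. *)
Lemma degenerate_null (b : 'cV[R]_p) i :
  (b^T *m S *m b) 0 0 = 0 ->
  (P [set t | (((Y t + E t) *m b) i 0 != 0)%R] = 0)%E.
Proof.
rewrite /S mulmxDr mulmxDl mxE => /eqP.
rewrite paddr_eq0 ?psd1.2 ?psd2.2// => /andP[/eqP v1 /eqP v2].
have H (S0 : 'M[R]_p) (X : T -> 'M[R]_(n, p)) : iid_gaussian_rows P S0 X ->
    (b^T *m S0 *m b) 0 0 = 0 -> P ((fun t => (X t *m b) i 0) @^-1` [set~ 0]) = 0%E.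
  move=> gX vX; have mX := gaussian_rows_random gX.
  have [/(_ i)[_ gi] _] := gX.
  have m0 : measurable ([set~ 0] : set R) by apply: measurableC.
  have := gi b [set~ 0] m0.
  rewrite vX /centered_gaussian eqxx diracE memNset; last by move=> /=; apply.
  move=> h; apply: etrans h.
  rewrite (_ : (fun t => (X t *m b) i 0) = (fun t => (row i (X t) *m b) 0 0)) //.
  by apply/funext => t; rewrite -row_mul [RHS]mxE.
apply/eqP; rewrite eq_le measure_ge0 andbT.
have mm (S0 : 'M[R]_p) (X : T -> 'M[R]_(n, p)) : iid_gaussian_rows P S0 X ->
    measurable ((fun t => (X t *m b) i 0) @^-1` [set~ 0]).
  move=> gX; rewrite -[X in measurable X]setTI.
  apply: (measurable_fun_gsigma (gen_mx_measurable (gaussian_rows_random gX))) => //.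
    exact: measurable_mulmx_gen.
  exact: measurableC.
pose N (X : T -> 'M[R]_(n, p)) := (fun t => (X t *m b) i 0) @^-1` [set~ 0].
have U : (P (N Y `|` N E) <= P (N Y) + P (N E))%E.
  by apply: measureU2; [exact: mm gY|exact: mm gE].
have NY : P (N Y) = 0%E by exact: H gY v1.
have NE : P (N E) = 0%E by exact: H gE v2.
move: U; rewrite NY NE adde0; apply: le_trans.
apply: le_measure; rewrite ?inE.
- have := measurable_mulmx_sum b i => /(_ measurableT [set~ 0]).
  rewrite setTI => h.
  rewrite (_ : [set _ | _] = (fun t => ((Y t + E t) *m b) i 0) @^-1` [set~ 0]).
    by apply: h; exact: measurableC.
  by apply/seteqP; split=> t /= /eqP.
- by apply: measurableU; [exact: mm gY|exact: mm gE].
- move=> t /=; rewrite mulmxDl mxE => /eqP h.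
  case: (eqVneq ((Y t *m b) i 0) 0) => [y0|/eqP]; last by left.
  by right => /= e0; apply: h; rewrite y0 e0 addr0.
Qed.
End Tails.

(** * Frobenius and mixed norms *)

Section Frobenius.
Context {R : realType}.

(** With B the sum of the squares of g and C the sum of f g, expanding the sum of
    the squares of B f - C g gives B times the defect of the inequality. *)
Lemma sum_CauchySchwarz (I : finType) (f g : I -> R) :
  (\sum_i f i * g i) ^+ 2 <= (\sum_i f i ^+ 2) * (\sum_i g i ^+ 2).
Proof.
set A := \sum_i f i ^+ 2; set B := \sum_i g i ^+ 2; set C := \sum_i f i * g i.
have B0 : 0 <= B by apply: sumr_ge0 => i _; rewrite sqr_ge0.
have H : 0 <= B * (A * B - C ^+ 2).
  have -> : B * (A * B - C ^+ 2) = \sum_i (B * f i - C * g i) ^+ 2.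
    transitivity (\sum_i (B ^+ 2 * f i ^+ 2 + (- (2 * B * C)) * (f i * g i)
        + C ^+ 2 * g i ^+ 2)).
      by rewrite !big_split /= -!mulr_sumr -/A -/B -/C; ring.
    by apply: eq_bigr => i _; ring.
  by apply: sumr_ge0 => i _; rewrite sqr_ge0.
move: B0; rewrite le_eqVlt => /orP[/eqP B0|B0]; last first.
  by rewrite -subr_ge0; rewrite pmulr_rge0 in H.
have g0 i : g i = 0.
  apply/eqP; rewrite -sqrf_eq0; apply/eqP.
  by move/esym/psumr_eq0P : B0; apply=> // j _; rewrite sqr_ge0.
by rewrite -B0 mulr0 /C big1 ?expr0n// => i _; rewrite g0 mulr0.
Qed.

Definition fnorm (m n : nat) (A : 'M[R]_(m, n)) : R :=
  Num.sqrt (\sum_i \sum_j A i j ^+ 2).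

Lemma sumsq_ge0 (m n : nat) (A : 'M[R]_(m, n)) : 0 <= \sum_i \sum_j A i j ^+ 2.
Proof. by apply: sumr_ge0 => i _; apply: sumr_ge0 => j _; rewrite sqr_ge0. Qed.

Lemma fnorm_ge0 (m n : nat) (A : 'M[R]_(m, n)) : 0 <= fnorm A.
Proof. exact: sqrtr_ge0. Qed.

Lemma fnorm_sqr (m n : nat) (A : 'M[R]_(m, n)) :
  fnorm A ^+ 2 = \sum_i \sum_j A i j ^+ 2.
Proof. by rewrite sqr_sqrtr// sumsq_ge0. Qed.

Lemma fnorm_sqr_col (n : nat) (u : 'cV[R]_n) : fnorm u ^+ 2 = \sum_i u i 0 ^+ 2.
Proof. by rewrite fnorm_sqr; apply: eq_bigr => i _; rewrite big_ord1. Qed.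

Lemma fnorm_sqr_cols (m n : nat) (A : 'M[R]_(m, n)) :
  fnorm A ^+ 2 = \sum_j fnorm (col j A) ^+ 2.
Proof.
rewrite fnorm_sqr exchange_big; apply: eq_bigr => j _; rewrite fnorm_sqr_col.
by apply: eq_bigr => i _; rewrite mxE.
Qed.

Lemma fnorm0 (m n : nat) : fnorm (0 : 'M[R]_(m, n)) = 0.
Proof.
rewrite /fnorm big1 ?sqrtr0// => i _; rewrite big1// => j _.
by rewrite mxE expr0n.
Qed.

Lemma fnormZ (m n : nat) (c : R) (A : 'M[R]_(m, n)) : fnorm (c *: A) = `|c| * fnorm A.
Proof.
rewrite -(sqrtr_sqr c) /fnorm -sqrtrM ?sqr_ge0//; congr Num.sqrt.
rewrite mulr_sumr; apply: eq_bigr => i _; rewrite mulr_sumr.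
by apply: eq_bigr => j _; rewrite mxE exprMn.
Qed.

Lemma fnormN (m n : nat) (A : 'M[R]_(m, n)) : fnorm (- A) = fnorm A.
Proof. by rewrite -scaleN1r fnormZ normrN1 mul1r. Qed.

Lemma fnormD (m n : nat) (A B : 'M[R]_(m, n)) : fnorm (A + B) <= fnorm A + fnorm B.
Proof.
rewrite -(@ler_pXn2r _ 2) ?nnegrE ?addr_ge0 ?fnorm_ge0//.
rewrite sqrrD !fnorm_sqr.
have -> : \sum_i \sum_j (A + B) i j ^+ 2 = \sum_i \sum_j A i j ^+ 2
   + (\sum_i \sum_j A i j * B i j) *+ 2 + \sum_i \sum_j B i j ^+ 2.
  rewrite -sumrMnl -!big_split /=; apply: eq_bigr => i _.
  rewrite -sumrMnl -!big_split /=; apply: eq_bigr => j _.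
  by rewrite mxE sqrrD.
rewrite lerD2r lerD2l lerMn2r /=.
apply: le_trans (ler_norm _) _; rewrite -(@ler_pXn2r _ 2) ?nnegrE ?mulr_ge0 ?fnorm_ge0//.
rewrite exprMn !fnorm_sqr real_normK ?num_real// !pair_big /=.
exact: (sum_CauchySchwarz (fun z => A z.1 z.2) (fun z => B z.1 z.2)).
Qed.

Lemma fnormB (m n : nat) (A B : 'M[R]_(m, n)) : fnorm A - fnorm B <= fnorm (A - B).
Proof. by rewrite lerBlDr; apply: le_trans (fnormD _ _); rewrite subrK. Qed.

Lemma fnorm_sum (m n : nat) (I : finType) (F : I -> 'M[R]_(m, n)) :
  fnorm (\sum_i F i) <= \sum_i fnorm (F i).
Proof.
elim/big_ind2 : _ => [|x1 x2 y1 y2 h1 h2|i _] //; first by rewrite fnorm0.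
by apply: le_trans (fnormD _ _) _; rewrite lerD.
Qed.

Lemma mixed_norm22E (m n : nat) (A : 'M[R]_(m, n)) : mixed_norm 2 2 A = fnorm A.
Proof.
rewrite /mixed_norm powR12_sqrt; last by apply: sumr_ge0 => i _; rewrite powR_ge0.
congr Num.sqrt; apply: eq_bigr => i _; rewrite powR_mulrn ?powR_ge0//.
rewrite /lqnorm powR12_sqrt; last by apply: sumr_ge0 => j _; rewrite powR_ge0.
rewrite sqr_sqrtr; last by apply: sumr_ge0 => j _; rewrite powR_ge0.
by apply: eq_bigr => j _; rewrite powR_mulrn// mxE real_normK ?num_real.
Qed.

Lemma mixed_norm11E (m n : nat) (A : 'M[R]_(m, n)) :
  mixed_norm 1 1 A = \sum_i \sum_j `|A i j|.
Proof.
rewrite /mixed_norm invr1 powRr1; last by apply: sumr_ge0 => i _; rewrite powR_ge0.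
apply: eq_bigr => i _; rewrite powRr1 ?powR_ge0// /lqnorm invr1 powRr1.
  by apply: eq_bigr => j _; rewrite powRr1// mxE.
by apply: sumr_ge0 => j _; rewrite powR_ge0.
Qed.

Lemma mixed_norm21E (m n : nat) (A : 'M[R]_(m, n)) :
  mixed_norm 2 1 A = \sum_i fnorm (row i A).
Proof.
rewrite /mixed_norm invr1 powRr1; last by apply: sumr_ge0 => i _; rewrite powR_ge0.
apply: eq_bigr => i _; rewrite powRr1 ?powR_ge0// /lqnorm.
rewrite powR12_sqrt; last by apply: sumr_ge0 => j _; rewrite powR_ge0.
rewrite /fnorm big_ord1; congr Num.sqrt.
by apply: eq_bigr => j _; rewrite powR_mulrn// real_normK ?num_real.
Qed.
End Frobenius.

(** * Symmetric matrices: square roots and spectral norm *)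

Section Symmetric.
Context {R : realType}.

Definition dotr (n : nat) (u v : 'rV[R]_n) : R := (u *m v^T) 0 0.

Lemma dotrE n (u v : 'rV[R]_n) : dotr u v = \sum_i u 0 i * v 0 i.
Proof. by rewrite /dotr mxE; apply: eq_bigr => i _; rewrite mxE. Qed.

Lemma dotrC n (u v : 'rV[R]_n) : dotr u v = dotr v u.
Proof. by rewrite !dotrE; apply: eq_bigr => i _; rewrite mulrC. Qed.

Lemma dotrDl n (u v w : 'rV[R]_n) : dotr (u + v) w = dotr u w + dotr v w.
Proof. by rewrite /dotr mulmxDl mxE. Qed.

Lemma dotrZl n c (u w : 'rV[R]_n) : dotr (c *: u) w = c * dotr u w.
Proof. by rewrite /dotr -scalemxAl mxE. Qed.

Lemma dotrDr n (u v w : 'rV[R]_n) : dotr w (u + v) = dotr w u + dotr w v.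
Proof. by rewrite dotrC dotrDl !(dotrC w). Qed.

Lemma dotrZr n c (u w : 'rV[R]_n) : dotr w (c *: u) = c * dotr w u.
Proof. by rewrite dotrC dotrZl (dotrC w). Qed.

Lemma dotrr n (u : 'rV[R]_n) : dotr u u = \sum_i u 0 i ^+ 2.
Proof. by rewrite dotrE; apply: eq_bigr => i _; rewrite expr2. Qed.

Lemma dotrr_ge0 n (u : 'rV[R]_n) : 0 <= dotr u u.
Proof. by rewrite dotrr sumr_ge0// => i _; rewrite sqr_ge0. Qed.

Lemma dotrr_eq0 n (u : 'rV[R]_n) : dotr u u = 0 -> u = 0.
Proof.
rewrite dotrr => /psumr_eq0P h; apply/rowP => i; rewrite mxE; apply/eqP.
by rewrite -sqrf_eq0; apply/eqP/h => // j _; rewrite sqr_ge0.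
Qed.

Lemma dotr_adj m n (A : 'M[R]_(m, n)) (u : 'rV[R]_m) (v : 'rV[R]_n) :
  dotr (u *m A) v = dotr u (v *m A^T).
Proof. by rewrite /dotr trmx_mul trmxK mulmxA. Qed.

Lemma psd_dotr n (A : 'M[R]_n) : psdmx A ->
  A^T = A /\ forall u, 0 <= dotr (u *m A) u.
Proof. by move=> [sA A0]; split=> // u; have := A0 u^T; rewrite trmxK. Qed.

Lemma dotr_psd n (A : 'M[R]_n) : A^T = A ->
  (forall u, 0 <= dotr (u *m A) u) -> psdmx A.
Proof. by move=> sA A0; split=> // u; have := A0 u^T; rewrite /dotr trmxK. Qed.

(** If w = u A, then the quadratic form at u - s w is - 2 s |w|^2 + O(s^2), which is
    negative for a small s > 0 unless w = 0. *)
Lemma psd_isotropic n (A : 'M[R]_n) (u : 'rV[R]_n) : A^T = A ->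
  (forall w, 0 <= dotr (w *m A) w) -> dotr (u *m A) u = 0 -> u *m A = 0.
Proof.
move=> sA A0 u0; apply: dotrr_eq0; set w := u *m A; set x := dotr w w.
pose c := dotr (w *m A) w.
have c0 : 0 <= c by apply: A0.
have x0 : 0 <= x by apply: dotrr_ge0.
have wu : dotr (w *m A) u = x by rewrite dotr_adj sA.
pose s := x / (c + 1).
have c1 : 0 < c + 1 by rewrite ltr_wpDl.
have := A0 (u - s *: w).
rewrite -scaleNr mulmxDl -scalemxAl !dotrDl !dotrDr !dotrZl !dotrZr u0 -/w -/x wu -/c.
rewrite (_ : _ + _ = - (x ^+ 2 * (c + 2) / (c + 1) ^+ 2)); last first.
  by rewrite /s; field; rewrite gt_eqF.
rewrite oppr_ge0 => h.
have : 0 <= x ^+ 2 * (c + 2) / (c + 1) ^+ 2.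
  by rewrite divr_ge0 ?mulr_ge0 ?sqr_ge0// addr_ge0.
move=> h'; have /eqP := le_anti (introT andP (conj h h')).
rewrite mulf_eq0 invr_eq0 mulf_eq0 !sqrf_eq0 (gt_eqF c1) orbF.
by rewrite (gt_eqF (_ : 0 < c + 2)) ?orbF ?ltr_wpDl// => /eqP.
Qed.

Lemma continuous_big_sum (V : topologicalType) (I : Type) (s : seq I) (f : I -> V -> R) :
  (forall i, continuous (f i)) -> continuous (fun v => \sum_(i <- s) f i v).
Proof.
move=> cf; elim: s => [|i s IH].
  by under eq_fun do rewrite big_nil; exact: cst_continuous.
under eq_fun do rewrite big_cons.
by move=> v; apply: continuousD; [exact: cf|exact: IH].
Qed.

(** The maximum of the Rayleigh quotient, which exists by compactness of the unit
    sphere, is an eigenvalue: l - A is positive semidefinite and its form vanishes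
    at the maximizer, so [psd_isotropic] applies. *)
Lemma rayleigh_max n (A : 'M[R]_n) : (0 < n)%N -> A^T = A ->
  exists u : 'rV[R]_n, exists l : R,
  [/\ dotr u u = 1, u *m A = l *: u & forall w, dotr (w *m A) w <= l * dotr w w].
Proof.
move=> n0 sA.
have coordc i : continuous (fun v : 'rV[R]_n => v 0 i) by exact: coord_continuous.
have cN : continuous (fun v : 'rV[R]_n => dotr v v).
  under eq_fun do rewrite dotrE; apply: continuous_big_sum => i v.
  by apply: continuousM; exact: coordc.
have cmul i : continuous (fun v : 'rV[R]_n => (v *m A) 0 i).
  under eq_fun do rewrite mxE.
  apply: continuous_big_sum => j v; apply: continuousM; first exact: coordc.
  exact: cst_continuous.
have cA : continuous (fun v : 'rV[R]_n => dotr (v *m A) v).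
  under eq_fun do rewrite dotrE; apply: continuous_big_sum => i v.
  by apply: continuousM; [exact: cmul|exact: coordc].
pose S := [set v : 'rV[R]_n | dotr v v = 1].
have cS : compact S.
  apply: (@subclosed_compact _ _
    [set v : 'rV[R]_n | forall i, `[-1, 1]%classic (v ord0 i)]).
  - rewrite (_ : S = (fun v => dotr v v) @^-1` [set x | x = 1])//.
    by apply: preimage_closed => [v _|]; [exact: cN|exact: closed_eq].
  - apply: (@rV_compact R n (fun=> `[-1, 1]%classic)) => i.
    exact: segment_compact.
  - move=> v; rewrite /S /= dotrr => v1 i; rewrite in_itv /= -ler_norml.
    rewrite -(@ler_pXn2r _ 2) ?nnegrE// expr1n real_normK ?num_real// -v1.
    by rewrite (bigD1 i)//= lerDl sumr_ge0// => j _; rewrite sqr_ge0.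
have S0 : S !=set0.
  exists (delta_mx 0 (Ordinal n0)); rewrite /S /= dotrr (bigD1 (Ordinal n0))//= mxE !eqxx.
  rewrite expr1n big1 ?addr0// => j /negbTE jn; by rewrite mxE jn andbF expr0n.
have [u uS hu] := EVT_max_rV S0 cS (continuous_subspaceT cA).
have u1 : dotr u u = 1 by move: uS; rewrite inE.
pose l := dotr (u *m A) u.
have hw w : dotr (w *m A) w <= l * dotr w w.
  have [w0|w0] := eqVneq (dotr w w) 0.
    by rewrite (dotrr_eq0 w0) mul0mx /dotr !mul0mx mxE mulr0.
  have wp : 0 < dotr w w by rewrite lt_def w0 dotrr_ge0.
  pose c := (Num.sqrt (dotr w w))^-1.
  have c2 : c * c = (dotr w w)^-1 by rewrite -expr2 exprVn sqr_sqrtr// ltW.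
  have /hu : c *: w \in S.
    by rewrite inE /S /= dotrZl dotrZr mulrA c2 mulVf.
  rewrite -scalemxAl dotrZl dotrZr mulrA c2 -/l => h.
  by move: h; rewrite ler_pdivrMl// mulrC.
exists u, l; split=> //.
have : u *m (l%:M - A) = 0.
  apply: psd_isotropic.
  - by rewrite linearB /= tr_scalar_mx sA.
  - move=> w; rewrite mulmxBr mul_mx_scalar -scaleN1r dotrDl !dotrZl mulN1r subr_ge0.
    exact: hw.
  - by rewrite mulmxBr mul_mx_scalar -scaleN1r dotrDl !dotrZl u1 -/l; ring.
by rewrite mulmxBr mul_mx_scalar => /eqP; rewrite subr_eq0 => /eqP.
Qed.

(** Deflation: if u is a unit eigenvector for the largest eigenvalue l > 0, then
    A - l u^T u is positive semidefinite, kills u and has smaller rank; adding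
    sqrt l u^T u to its square root gives a square root of A. *)
Lemma psd_sqrt n (A : 'M[R]_n) : psdmx A -> exists S, psdmx S /\ S *m S = A.
Proof.
have [k] := ubnP (\rank A); elim: k A => // k IH A rA pA.
have [sA A0] := psd_dotr pA.
have zero_case : A = 0 -> exists S, psdmx S /\ S *m S = A.
  move=> ->; exists 0; split; last by rewrite mulmx0.
  by apply: dotr_psd => [|u]; rewrite ?trmx0// mulmx0 /dotr mul0mx mxE.
have [n0|n0] := posnP n.
  by apply: zero_case; apply/matrixP => i; exfalso; case: i => i; rewrite n0.
have [u [l [u1 uA hl]]] := rayleigh_max n0 sA.
have [l0|l0] := lerP l 0.
  apply: zero_case; apply/row_matrixP => i; rewrite row0 rowE.
  apply: psd_isotropic => //; apply/eqP; rewrite eq_le A0 andbT.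
  by apply: le_trans (hl _) _; rewrite mulr_le0_ge0// dotrr_ge0.
pose A' := A - l *: (u^T *m u).
have wA' w : w *m A' = w *m A - (l * dotr w u) *: u.
  rewrite mulmxBr -scalemxAr mulmxA; congr (_ - _).
  by rewrite [w *m u^T]mx11_scalar mul_scalar_mx scalerA.
have uA' : u *m A' = 0 by rewrite wA' u1 mulr1 uA subrr.
have sA' : A'^T = A'.
  by rewrite linearB linearZ /= trmx_mul trmxK sA.
have pA' : psdmx A'.
  apply: dotr_psd => // w; rewrite wA' -scaleNr dotrDl dotrZl.
  pose a := dotr w u; have := A0 (w - a *: u).
  rewrite mulmxDl -scaleNr -scalemxAl uA !dotrDl !dotrDr !dotrZl !dotrZr u1.
  rewrite (dotr_adj A w u) sA uA dotrZr (dotrC u w) -/a.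
  by move=> h; apply: le_trans h _; rewrite le_eqVlt; apply/orP; left; apply/eqP; ring.
have rA' : (\rank A' < \rank A)%N.
  have uinA : (u <= A)%MS.
    apply/submxP; exists (l^-1 *: u); rewrite -scalemxAl uA scalerA mulVf ?scale1r//.
    by rewrite gt_eqF.
  apply: rank_ltmx; rewrite /ltmx; apply/andP; split.
    rewrite /A'; apply: addmx_sub => //; rewrite eqmx_opp.
    by apply: scalemx_sub; apply: mulmx_sub.
  apply/negP => AA'; have /submxP [w uw] := submx_trans uinA AA'.
  have := u1; rewrite {1}uw dotr_adj sA' uA' /dotr trmx0 mulmx0 mxE => /esym/eqP.
  by rewrite oner_eq0.
have [S' [pS' S'2]] := IH A' (leq_trans rA' rA) pA'.
have [sS' S'0] := psd_dotr pS'.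
have uS' : u *m S' = 0.
  by apply: dotrr_eq0; rewrite dotr_adj sS' -mulmxA S'2 uA' /dotr trmx0 mulmx0 mxE.
have S'u : S' *m u^T = 0 by rewrite -{1}sS' -trmx_mul uS' trmx0.
exists (S' + Num.sqrt l *: (u^T *m u)); split.
  apply: dotr_psd => [|w].
    by rewrite linearD linearZ /= trmx_mul trmxK sS'.
  rewrite mulmxDr dotrDl addr_ge0// -scalemxAr dotrZl mulr_ge0 ?sqrtr_ge0//.
  rewrite mulmxA [w *m u^T]mx11_scalar mul_scalar_mx dotrZl -/(dotr w u) (dotrC u w).
  by rewrite -expr2 sqr_ge0.
have e1 : S' *m (u^T *m u) = 0 by rewrite mulmxA S'u mul0mx.
have e2 : u^T *m u *m S' = 0 by rewrite -mulmxA uS' mulmx0.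
have e3 : u^T *m u *m (u^T *m u) = u^T *m u.
  rewrite mulmxA -[u^T *m u *m _]mulmxA.
  have -> : u *m u^T = 1%:M by rewrite [LHS]mx11_scalar -/(dotr u u) u1.
  by rewrite mulmx1.
rewrite mulmxDr !mulmxDl S'2 -!scalemxAl -!scalemxAr e1 e2 e3.
by rewrite !scaler0 addr0 add0r scalerA -expr2 sqr_sqrtr ?ltW// subrK.
Qed.

Lemma sqrtmxP n (A : 'M[R]_n) : psdmx A ->
  psdmx (sqrtmx A) /\ sqrtmx A *m sqrtmx A = A.
Proof. by move=> /psd_sqrt[S hS]; rewrite /sqrtmx; case: xgetP => [S' _ //|/(_ S)]. Qed.

(** For an invertible matrix the first Penrose condition already forces the
    inverse. *)
Lemma mpinvmx_unit n (S : 'M[R]_n) : S \in unitmx -> mpinvmx S *m S = 1%:M.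
Proof.
move=> uS; rewrite /mpinvmx; case: xgetP => [G _ [SGS _ _ _]|/(_ (invmx S))].
  by rewrite -[LHS]mul1mx -(mulVmx uS) -mulmxA [S *m _]mulmxA SGS.
case; split; rewrite ?mulmxV ?mulVmx ?mul1mx ?trmx1//.
Qed.

(** The largest singular value is the square root of the maximum of the Rayleigh
    quotient of A^T A; the bound on the product is read off column by column. *)
Lemma spectral_norm_bound (m n p : nat) (A : 'M[R]_(m, n)) (M : 'M[R]_(n, p)) :
  (0 < n)%N ->
  0 <= spectral_norm A /\ fnorm (A *m M) <= spectral_norm A * fnorm M.
Proof.
move=> n0; pose B := A^T *m A.
have sB : B^T = B by rewrite trmx_mul trmxK.
have qB w : dotr (w *m B) w = \sum_i ((A *m w^T) i 0) ^+ 2.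
  rewrite /B mulmxA dotr_adj dotrr; apply: eq_bigr => i _.
  by rewrite -[in RHS](trmxK A) -trmx_mul [in RHS]mxE.
have [u [l [u1 uB hl]]] := rayleigh_max n0 sB.
have eigen_ub : ubound (singular_value A) (Num.sqrt l).
  move=> _ [k /eigenvalueP[v vB v0] ->]; apply: ler_wsqrtr.
  have vp : 0 < dotr v v.
    by rewrite lt_def dotrr_ge0 andbT; apply: contra_neq v0 => /dotrr_eq0.
  by have := hl v; rewrite [v *m B]vB dotrZl ler_pM2r.
have lS : singular_value A (Num.sqrt l).
  exists l => //; apply/eigenvalueP; exists u => //.
  apply/eqP => u0; have := u1; rewrite u0 /dotr mul0mx mxE => /esym/eqP.
  by rewrite oner_eq0.
have nE : spectral_norm A = Num.sqrt l.
  apply/eqP; rewrite eq_le; apply/andP; split.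
    by apply: ge_sup => //; exists (Num.sqrt l).
  by apply: ub_le_sup => //; exists (Num.sqrt l).
rewrite nE sqrtr_ge0; split=> //.
have l0 : 0 <= l by rewrite -[l]mulr1 -u1 -dotrZl -uB qB sumr_ge0// => i _; rewrite sqr_ge0.
rewrite -(@ler_pXn2r _ 2) ?nnegrE ?mulr_ge0 ?sqrtr_ge0 ?fnorm_ge0//.
rewrite exprMn (sqr_sqrtr l0) !fnorm_sqr_cols mulr_sumr; apply: ler_sum => j _.
have := hl (col j M)^T; rewrite qB trmxK -!fnorm_sqr_col.
rewrite -(_ : col j (A *m M) = A *m col j M); last first.
  by apply/matrixP => i k; rewrite !mxE; apply: eq_bigr => h _; rewrite !mxE.
rewrite dotrr !fnorm_sqr_col.
by rewrite (eq_bigr (fun i => col j M i 0 ^+ 2)) // => i _; rewrite mxE.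
Qed.
End Symmetric.

(** * Maurey's empirical method *)

Section Maurey.
Context {R : realType}.

Lemma weighted_mean_exists (I : finType) (w f : I -> R) (B : R) :
  (forall i, 0 <= w i) -> \sum_i w i = 1 -> \sum_i w i * f i <= B ->
  exists i, f i <= B.
Proof.
move=> w0 w1 hB; apply: contrapT => /forallNP h.
have fB i : B < f i by rewrite ltNge; apply/negP/h.
have g0 i : 0 <= w i * (f i - B) by rewrite mulr_ge0// subr_ge0 ltW.
have gs : \sum_i w i * (f i - B) = 0.
  apply/eqP; rewrite eq_le sumr_ge0 ?andbT//.
  under eq_bigr do rewrite mulrBr.
  by rewrite sumrB -mulr_suml w1 mul1r subr_le0.
have wz i : w i = 0.
  have /eqP := (psumr_eq0P (fun i _ => g0 i) gs) i isT.
  by rewrite mulf_eq0 subr_eq0 (gt_eqF (fB i)) orbF => /eqP.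
by move: w1; rewrite big1// => /esym/eqP; rewrite oner_eq0.
Qed.

(** Points are chosen greedily.  If D is the current deviation from k times the
    mean, then the mean over i, with the weights w, of |D + x_i - y|^2 is at most
    |D|^2 + C, the cross term being zero on average; so some x_i raises |D|^2 by at
    most C. *)
Lemma maurey (I : finType) (m : nat) (w : I -> R) (x : I -> 'cV[R]_m) (C : R) :
  (forall i, 0 <= w i) -> \sum_i w i = 1 -> (forall i, fnorm (x i) ^+ 2 <= C) ->
  forall k, exists s : k.-tuple I,
    fnorm (\sum_(i <- s) x i - k%:R *: \sum_i w i *: x i) ^+ 2 <= k%:R * C.
Proof.
move=> w0 w1 hC; set y := \sum_i w i *: x i.
elim=> [|k [s hs]].
  exists [tuple]; rewrite big_nil scale0r subr0 fnorm0 mul0r.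
  by rewrite expr0n.
set D := \sum_(i <- s) x i - k%:R *: y in hs.
pose f i := fnorm (D + (x i - y)) ^+ 2.
have [i hi] : exists i, f i <= fnorm D ^+ 2 + C.
  apply: (weighted_mean_exists w0 w1).
  have yE c : y c 0 = \sum_i w i * x i c 0.
    by rewrite /y summxE; apply: eq_bigr => i _; rewrite mxE.
  have -> : \sum_i w i * f i =
      \sum_c (D c 0 ^+ 2 - y c 0 ^+ 2) + \sum_i w i * fnorm (x i) ^+ 2.
    have swap (z : I -> 'cV[R]_m) :
        \sum_i w i * fnorm (z i) ^+ 2 = \sum_c \sum_i w i * z i c 0 ^+ 2.
      rewrite exchange_big; apply: eq_bigr => i _.
      by rewrite fnorm_sqr_col mulr_sumr.
    rewrite /f (swap (fun i => D + (x i - y))) swap -big_split.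
    apply: eq_bigr => c _ /=.
    transitivity (\sum_i ((D c 0 - y c 0) ^+ 2 * w i
        + 2 * (D c 0 - y c 0) * (w i * x i c 0) + w i * x i c 0 ^+ 2)).
      by apply: eq_bigr => i _; rewrite !mxE; ring.
    by rewrite !big_split /= -!mulr_sumr w1 -yE; ring.
  apply: lerD.
    rewrite fnorm_sqr_col; apply: ler_sum => c _.
    by rewrite lerBlDr lerDl sqr_ge0.
  rewrite -[C]mul1r -w1 mulr_suml; apply: ler_sum => i _.
  exact: ler_wpM2l.
exists [tuple of i :: s]; rewrite /= big_cons.
have -> : x i + \sum_(j <- s) x j - k.+1%:R *: y = D + (x i - y).
  rewrite -natr1 scalerDl scale1r /D; set X := \sum_(j <- s) x j.
  by apply/matrixP => c e; rewrite !mxE; ring.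
by apply: le_trans hi _; rewrite -natr1 mulrDl mul1r lerD2r.
Qed.

(** The zero vector is included among the signed coordinate vectors so that their
    convex hull contains the ball of radius [K], and not only the sphere, with a
    scale [K] that is the same for all vectors to be approximated. *)
Definition atom (p : nat) (o : option ('I_p * bool)) : 'cV[R]_p :=
  if o is Some (j, e) then (if e then 1 else -1) *: delta_mx j 0 else 0.

Definition net_point (p k : nat) (K : R) (s : k.-tuple (option ('I_p * bool))) : 'cV[R]_p :=
  (K / k%:R) *: \sum_(o <- s) atom o.

Lemma net_card (p k : nat) :
  #|{: k.-tuple (option ('I_p * bool))}| = ((2 * p).+1 ^ k)%N.
Proof. by rewrite card_tuple card_option card_prod card_ord card_bool mulnC. Qed.

(** [L] is arbitrary: one and the same net point is good for every seminorm whose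
    values at the coordinate vectors are bounded. *)
Lemma net_point_approx (p k m : nat) (K C : R) (L : 'M[R]_(m, p)) (b : 'cV[R]_p) :
  (0 < k)%N -> 0 < K -> \sum_j `|b j 0| <= K -> 0 <= C ->
  (forall j, fnorm (col j L) ^+ 2 <= C) ->
  exists s : k.-tuple (option ('I_p * bool)),
    fnorm (L *m (net_point K s - b)) ^+ 2 <= K ^+ 2 * C / k%:R.
Proof.
move=> k0 K0 bK C0 hC.
pose pos (x : R) := if 0 <= x then x else 0.
(* the convex weights that represent b / K *)
pose w (o : option ('I_p * bool)) : R :=
  if o is Some (j, e) then pos (if e then b j 0 else - b j 0) / K
  else 1 - (\sum_j `|b j 0|) / K.
have sumo (V : nmodType) (F : option ('I_p * bool) -> V) :
    \sum_o F o = F None + \sum_j (F (Some (j, true)) + F (Some (j, false))).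
  rewrite (bigD1 None)//=; congr (_ + _).
  rewrite (reindex_omap Some id) /=; last by case.
  rewrite (eq_bigl xpredT); last by move=> z; rewrite eqxx.
  rewrite (eq_bigr (fun z => F (Some (z.1, z.2)))); last by case.
  rewrite -(pair_bigA _ (fun j e => F (Some (j, e)))) /=.
  by apply: eq_bigr => j _; rewrite big_bool.
have w0 o : 0 <= w o.
  case: o => [[j e]|] /=.
    by rewrite divr_ge0 ?(ltW K0)// /pos; case: ifP.
  by rewrite subr_ge0 ler_pdivrMr// mul1r.
have posD (x : R) : pos x + pos (- x) = `|x|.
  rewrite /pos oppr_ge0; case: (lerP 0 x) => h.
    by rewrite ger0_norm//; case: (lerP x 0) => h'; lra.
  by rewrite ltr0_norm// (ltW h) add0r.
have posB (x : R) : pos x - pos (- x) = x.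
  rewrite /pos oppr_ge0; case: (lerP 0 x) => h.
    by case: (lerP x 0) => h'; lra.
  by rewrite (ltW h); lra.
have w1 : \sum_o w o = 1.
  rewrite sumo /=.
  rewrite [X in _ + X](_ : _ = \sum_j `|b j 0| / K); last first.
    by apply: eq_bigr => j _; rewrite -mulrDl posD.
  by rewrite -mulr_suml subrK.
have [|s hs] := @maurey _ m w (fun o => L *m atom o) C w0 w1 _ k.
  move=> [[j e]|] /=; last by rewrite mulmx0 fnorm0 expr0n.
  rewrite -scalemxAr fnormZ -colE; case: e; rewrite ?normrN1 ?normr1 mul1r; exact: hC.
have yE : \sum_o w o *: (L *m atom o) = K^-1 *: (L *m b).
  rewrite sumo /= mulmx0 scaler0 add0r.
  transitivity (L *m (\sum_j (b j 0 / K) *: delta_mx j 0 : 'cV[R]_p)).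
    rewrite mulmx_sumr; apply: eq_bigr => j _.
    rewrite scale1r scaleN1r mulmxN scalerN -scalerBl -mulrBl posB.
    by rewrite scalemxAr.
  rewrite scalemxAr; congr (_ *m _); apply/colP => i; rewrite summxE mxE.
  rewrite (bigD1 i)//= !mxE !eqxx mulr1 big1 ?addr0 1?mulrC// => j /negbTE ji.
  by rewrite !mxE eq_sym ji mulr0.
exists s; move: hs; rewrite yE -mulmx_sumr => hs.
have -> : L *m (net_point K s - b) =
    (K / k%:R) *: (L *m (\sum_(i <- s) atom i) - k%:R *: (K^-1 *: (L *m b))).
  rewrite mulmxBr /net_point -scalemxAr scalerBr; congr (_ - _).
  rewrite !scalerA (_ : K / k%:R * (k%:R / K) = 1) ?scale1r//.
  by field; rewrite !gt_eqF// ltr0n.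
rewrite fnormZ exprMn real_normK ?num_real//.
have kR : 0 < k%:R :> R by rewrite ltr0n.
apply: le_trans (ler_wpM2l _ hs) _; first by rewrite sqr_ge0.
by rewrite le_eqVlt; apply/orP; left; apply/eqP; field; rewrite gt_eqF.
Qed.

Lemma fnorm_mulmx_l1 (m p : nat) (L : 'M[R]_(m, p)) (b : 'cV[R]_p) (c : R) :
  (forall j, fnorm (col j L) <= c) -> fnorm (L *m b) <= c * \sum_j `|b j 0|.
Proof.
move=> hc.
have -> : L *m b = \sum_j b j 0 *: col j L.
  apply/colP => i; rewrite mxE summxE; apply: eq_bigr => j _.
  by rewrite !mxE mulrC.
apply: le_trans (fnorm_sum _) _; rewrite mulr_sumr; apply: ler_sum => j _.
by rewrite fnormZ mulrC; apply: ler_wpM2r.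
Qed.

Lemma fnorm_col_mx (m1 m2 n : nat) (A : 'M[R]_(m1, n)) (B : 'M[R]_(m2, n)) :
  fnorm (col_mx A B) ^+ 2 = fnorm A ^+ 2 + fnorm B ^+ 2.
Proof.
rewrite !fnorm_sqr big_split_ord /=; congr (_ + _); apply: eq_bigr => i _;
  by apply: eq_bigr => j _; rewrite ?col_mxEu ?col_mxEd.
Qed.
End Maurey.

(** * Finite nets for the weighted l1 balls *)

Section Nets.
Context {R : realType}.

Definition l1norm (p : nat) (u : 'cV[R]_p) : R := \sum_j `|u j 0|.

Lemma l1norm_ge0 (p : nat) (u : 'cV[R]_p) : 0 <= l1norm u.
Proof. by apply: sumr_ge0. Qed.

Lemma natr_expR_ln (m : nat) : (0 < m)%N -> m%:R = expR (ln m%:R) :> R.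
Proof. by move=> m0; rewrite lnK// posrE ltr0n. Qed.

Lemma expR_ge_pow2 (m : nat) : 2 ^+ m <= expR m%:R :> R.
Proof.
rewrite -[m%:R]mulr1 mulrC expRM_natr.
by apply: lerXn2r; rewrite ?nnegrE ?expR_ge0// expR1_ge2.
Qed.

(** The tangent to the exponential at 8, together with 26 * 8 = 208 and
    e^8 >= 2^8 >= 208. *)
Lemma ln_le_frac (n : nat) : (208 <= n)%N -> ln n%:R <= n%:R / 26 :> R.
Proof.
move=> hn; have n0 : (0 < n)%N by apply: leq_trans hn.
have nR : 208 <= n%:R :> R by rewrite (ler_nat R 208 n).
rewrite -ler_expR lnK ?posrE ?ltr0n//.
have -> : n%:R / 26 = 8%:R + (n%:R / 26 - 8) :> R by ring.
rewrite expRD.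
have h1 : 256 <= expR 8%:R :> R by apply: le_trans (expR_ge_pow2 8); lra.
have h2 : 1 + (n%:R / 26 - 8) <= expR (n%:R / 26 - 8) :> R := expR_ge1Dx _.
have h3 : 0 <= n%:R / 26 - 8 :> R by lra.
have : 256 * (1 + (n%:R / 26 - 8)) <= expR 8%:R * expR (n%:R / 26 - 8) :> R.
  by apply: ler_pM; lra.
by apply: le_trans; lra.
Qed.

Lemma double_lt_cube (q : nat) : (2 <= q)%N -> (2 * q < q ^ 3)%N.
Proof.
move=> q2; have q0 : (0 < q)%N by apply: leq_trans q2.
rewrite !expnS expn0 muln1; apply: (@leq_ltn_trans (q * q)%N).
  by rewrite leq_mul2r q2 orbT.
by rewrite ltn_Pmull// muln_gt0 q0.
Qed.

(** Cardinalities of nets: here a + 1 = 2 q + 1 is the number of atoms. *)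
Lemma pow_le_expR (a q k : nat) : (0 < q)%N -> (a.+1 <= q ^ 3)%N ->
  ((a.+1 ^ k)%N)%:R <= expR (k%:R * (3 * ln q%:R)) :> R.
Proof.
move=> q0 h; rewrite natrX mulrC expRM_natr.
apply: lerXn2r; rewrite ?nnegrE ?expR_ge0 ?ler0n//.
rewrite mulrC (expRM_natr 3) -natr_expR_ln// -natrX ler_nat//.
Qed.

Variables (n p : nat).
Hypotheses (hn : (208 <= n)%N) (hp : (1 <= p)%N).
Let s : R := Num.sqrt (ln p%:R / n%:R).
Let t : R := Num.sqrt (ln n%:R / n%:R).

Lemma n_ge : 208 <= n%:R :> R.
Proof. by rewrite (ler_nat R 208 n). Qed.

(** The l1 norm of th is at most K = 24 / (3300 t) = 2 / (275 t), so that k ~ 400 K^2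
    atoms give an error of 1/20.  As K^2 ln n = (2 / 275)^2 n, the logarithm of the
    number of net points, about 3 k ln n, is linear in n. *)
Lemma response_net : exists (N : finType) (pt : N -> 'cV[R]_n),
  #|N|%:R <= expR (18 / 100 * n%:R) :> R /\
  forall th : 'cV[R]_n, 33 * l1norm th * t <= 24 / 100 ->
    exists i, fnorm (pt i - th) <= 1 / 20.
Proof.
have nR := n_ge.
have lnn0 : 0 < ln n%:R :> R by apply: ln_gt0; lra.
have t0 : 0 < t by rewrite sqrtr_gt0 divr_gt0//; lra.
have t2 : t ^+ 2 = ln n%:R / n%:R by rewrite sqr_sqrtr// divr_ge0// ltW.
pose K := 2 / 275 / t.
have K0 : 0 < K by apply: divr_gt0; [lra|].
pose k := (Num.trunc (400 * K ^+ 2)).+1.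
have kK : 400 * K ^+ 2 < k%:R /\ k%:R <= 400 * K ^+ 2 + 1.
  have h0 : 0 <= 400 * K ^+ 2 by have := sqr_ge0 K; lra.
  have /andP[h1 h2] := truncn_itv h0; split => //.
  by rewrite /k -natr1 lerD2r.
exists (k.-tuple (option ('I_n * bool))), (fun o => net_point K o); split.
  rewrite net_card; apply: le_trans (pow_le_expR _ (q := n) _ _) _.
  - by apply: leq_trans hn.
  - by apply: double_lt_cube; apply: leq_trans hn.
  rewrite ler_expR.
  have K2 : K ^+ 2 * ln n%:R = (2 / 275) ^+ 2 * n%:R.
    by rewrite /K exprMn exprVn t2; field; rewrite gt_eqF//; lra.
  have h := ln_le_frac hn; case: kK => _ kK.
  apply: le_trans (_ : (400 * K ^+ 2 + 1) * (3 * ln n%:R) <= _).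
    by rewrite ler_pM2r// mulr_gt0.
  have -> : (400 * K ^+ 2 + 1) * (3 * ln n%:R) =
      1200 * (K ^+ 2 * ln n%:R) + 3 * ln n%:R by ring.
  rewrite K2; lra.
move=> th hth.
have hK : l1norm th <= K by rewrite /K ler_pdivlMr//; lra.
have [|o ho] := @net_point_approx _ n k n K 1 1%:M th isT K0 hK ler01.
  move=> j; rewrite fnorm_sqr_col (bigD1 j)//= !mxE eqxx expr1n big1 ?addr0//.
  by move=> i /negbTE ij; rewrite !mxE ij expr0n.
exists o; rewrite -(@ler_pXn2r _ 2) ?nnegrE ?fnorm_ge0//.
rewrite mul1mx in ho; apply: le_trans ho _.
rewrite mulr1 ler_pdivrMr ?ltr0n//; case: kK => kK _; lra.
Qed.

Variables (S : 'M[R]_p) (r : R).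
Hypotheses (r0 : 0 <= r) (hS : forall j, fnorm (col j S) <= r).
Hypothesis hS1 : p = 1%N -> forall j, fnorm (col j S) = r.

Lemma s_sqr : s ^+ 2 = ln p%:R / n%:R.
Proof. by rewrite sqr_sqrtr// divr_ge0// ln_ge0// ler1n. Qed.

(** The same computation, with K = 24 / (3600 r s) = 1 / (150 r s); the condition on s
    keeps the rounding of k cheap.  Two cases are treated apart.  If r = 0 then S b and Z b vanish for all b.  If p = 1 then s = 0 and the
    l1 norm is not restricted, but |b| <= 1 confines b to an interval, for which a
    regular grid suffices. *)
Lemma coefficient_net : s <= 1 / 80 -> exists (N : finType) (pt : N -> 'cV[R]_p),
  #|N|%:R <= expR (6 / 100 * n%:R) :> R /\
  forall Z : 'M[R]_(n, p),
    (forall j, fnorm (col j Z) ^+ 2 <= (3 + 4 * s ^+ 2) * r ^+ 2) ->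
  forall b : 'cV[R]_p, fnorm (S *m b) <= 1 -> 36 * r * l1norm b * s <= 24 / 100 ->
    exists i, fnorm (S *m (pt i - b)) ^+ 2 + fnorm (Z *m (pt i - b)) ^+ 2
       <= (11 / 100) ^+ 2.
Proof.
move=> hs; have nR := n_ge; have s0 : 0 <= s by exact: sqrtr_ge0.
have s2 := s_sqr.
have s2b : s ^+ 2 <= (1 / 80) ^+ 2 by apply: lerXn2r; rewrite ?nnegrE//; lra.
have D0 : 0 <= 4 + 4 * s ^+ 2 by have := sqr_ge0 s; lra.
have colL (Z : 'M[R]_(n, p))
    (hZ : forall j, fnorm (col j Z) ^+ 2 <= (3 + 4 * s ^+ 2) * r ^+ 2) j :
    fnorm (col j (col_mx S Z)) ^+ 2 <= (4 + 4 * s ^+ 2) * r ^+ 2.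
  rewrite col_col_mx fnorm_col_mx.
  have -> : (4 + 4 * s ^+ 2) * r ^+ 2 = r ^+ 2 + (3 + 4 * s ^+ 2) * r ^+ 2 by ring.
  by apply: lerD; [apply: lerXn2r; rewrite ?nnegrE ?fnorm_ge0|exact: hZ].
have LE (Z : 'M[R]_(n, p)) u : fnorm (col_mx S Z *m u) ^+ 2 =
    fnorm (S *m u) ^+ 2 + fnorm (Z *m u) ^+ 2.
  by rewrite mul_col_mx fnorm_col_mx.
have [r00|rn0] := eqVneq r 0.
  exists unit, (fun=> 0); split.
    by rewrite card_unit; apply: le_trans (expR_ge1Dx _); lra.
  move=> Z hZ b _ _; exists tt; rewrite -LE sub0r mulmxN fnormN.
  have : fnorm (col_mx S Z *m b) <= 0 * l1norm b.
    apply: fnorm_mulmx_l1 => j; rewrite -(@ler_pXn2r _ 2) ?nnegrE ?fnorm_ge0//.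
    by apply: le_trans (colL Z hZ j) _; rewrite r00 expr0n mulr0.
  rewrite mul0r => h; have -> : fnorm (col_mx S Z *m b) = 0.
    by apply/eqP; rewrite eq_le h fnorm_ge0.
  by rewrite expr0n sqr_ge0.
have rp : 0 < r by rewrite lt_def rn0.
have [p1|p1] := leqP p 1.
  have pE : p = 1%N by apply/eqP; rewrite eqn_leq p1 hp.
  pose j0 : 'I_p := Ordinal hp.
  have jE (j : 'I_p) : j = j0.
    by apply/val_inj => /=; case: j => j /=; rewrite {1}pE ltnS leqn0 => /eqP.
  exists 'I_41, (fun i : 'I_41 => const_mx (((i : nat)%:R - 20) / (20 * r))); split.
    rewrite card_ord; apply: le_trans (_ : expR 6%:R <= _).
      by apply: le_trans (expR_ge_pow2 6); lra.
    by rewrite ler_expR; lra.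
  move=> Z hZ b hb _.
  have bS : `|b j0 0| * r <= 1.
    apply: le_trans hb; rewrite -(hS1 pE j0) -fnormZ le_eqVlt; apply/orP; left; apply/eqP.
    congr fnorm; apply/colP => i; rewrite !mxE (bigD1 j0)//= big1 ?addr0 1?mulrC//.
    by move=> j; rewrite (jE j) eqxx.
  pose x := 20 * (b j0 0 * r + 1).
  have /andP[xl xu] : -1 <= b j0 0 * r <= 1 by rewrite -ler_norml normrM (gtr0_norm rp).
  have x0 : 0 <= x by rewrite /x; lra.
  have /andP[h1 h2] := truncn_itv x0.
  have h40 : (Num.trunc x < 41)%N.
    rewrite -(ltr_nat R); apply: le_lt_trans h1 _; rewrite /x; lra.
  exists (Ordinal h40); rewrite -LE.
  set u := const_mx _ - b.
  have uE : `|u j0 0| <= 1 / (20 * r).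
    rewrite /u !mxE /=; set m : R := (Num.trunc x)%:R in h1 *.
    have -> : (m - 20) / (20 * r) - b j0 0 = (m - x) / (20 * r).
      by rewrite /x; field; rewrite gt_eqF.
    rewrite normrM [`|_^-1|]gtr0_norm ?invr_gt0 ?mulr_gt0//.
    rewrite ler_pM2r ?invr_gt0 ?mulr_gt0// ler_norml.
    move: h2; rewrite -natr1 -/m; lra.
  have : fnorm (col_mx S Z *m u) <= (Num.sqrt (4 + 4 * s ^+ 2) * r) * l1norm u.
    apply: fnorm_mulmx_l1 => j.
    rewrite -(@ler_pXn2r _ 2) ?nnegrE ?fnorm_ge0 ?mulr_ge0 ?sqrtr_ge0//.
    by rewrite exprMn (sqr_sqrtr D0); exact: colL.
  have -> : l1norm u = `|u j0 0|.
    by rewrite /l1norm (bigD1 j0)//= big1 ?addr0// => j; rewrite (jE j) eqxx.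
  move=> h; have h' : fnorm (col_mx S Z *m u) <= Num.sqrt (4 + 4 * s ^+ 2) / 20.
    apply: le_trans h _.
    apply: le_trans (_ : Num.sqrt (4 + 4 * s ^+ 2) * r * (1 / (20 * r)) <= _).
      by apply: ler_wpM2l => //; rewrite mulr_ge0 ?sqrtr_ge0.
    by rewrite le_eqVlt; apply/orP; left; apply/eqP; field; rewrite gt_eqF.
  apply: le_trans (lerXn2r _ _ _ h') _; rewrite ?nnegrE ?fnorm_ge0 ?divr_ge0 ?sqrtr_ge0//.
  rewrite exprMn (sqr_sqrtr D0).
  by rewrite exprVn; lra.
have pR : 2 <= p%:R :> R by rewrite (ler_nat R 2 p).
have lnp0 : 0 < ln p%:R :> R by apply: ln_gt0; lra.
have sp : 0 < s by rewrite sqrtr_gt0 divr_gt0//; lra.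
pose K := 1 / 150 / (r * s).
have rs : 0 < r * s by rewrite mulr_gt0.
have K0 : 0 < K by apply: divr_gt0; [lra|].
pose k := (Num.trunc (400 * (K * r) ^+ 2)).+1.
have kK : 400 * (K * r) ^+ 2 < k%:R /\ k%:R <= 400 * (K * r) ^+ 2 + 1.
  have h0 : 0 <= 400 * (K * r) ^+ 2 by have := sqr_ge0 (K * r); lra.
  have /andP[h1 h2] := truncn_itv h0; split => //.
  by rewrite /k -natr1 lerD2r.
(* 2 p + 1 <= p^3 turns the cardinality into a power of p *)
exists (k.-tuple (option ('I_p * bool))), (fun o => net_point K o); split.
  rewrite net_card; apply: le_trans (pow_le_expR _ (q := p) _ _) _ => //.
    exact: double_lt_cube.
  rewrite ler_expR.
  have K2 : (K * r) ^+ 2 * ln p%:R = (1 / 150) ^+ 2 * n%:R.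
    have -> : ln p%:R = s ^+ 2 * n%:R :> R.
      by rewrite s2 divfK// gt_eqF//; lra.
    by rewrite /K; field; rewrite !gt_eqF.
  have h : ln p%:R <= n%:R / 6400 :> R.
    move: s2b; rewrite s2 ler_pdivrMr; last by lra.
    by move=> h; apply: le_trans h _; lra.
  case: kK => _ kK.
  apply: le_trans (_ : (400 * (K * r) ^+ 2 + 1) * (3 * ln p%:R) <= _).
    by rewrite ler_pM2r// mulr_gt0.
  have -> : (400 * (K * r) ^+ 2 + 1) * (3 * ln p%:R) =
      1200 * ((K * r) ^+ 2 * ln p%:R) + 3 * ln p%:R by ring.
  rewrite K2; lra.
move=> Z hZ b _ hb.
have hK : l1norm b <= K.
  rewrite /K ler_pdivlMr ?mulr_gt0//.
  have -> : l1norm b * (r * s) = (36 * r * l1norm b * s) / 36 by field.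
  lra.
have C0 : 0 <= (4 + 4 * s ^+ 2) * r ^+ 2.
  by rewrite mulr_ge0 ?sqr_ge0.
have [q hq] :=
  @net_point_approx _ p k _ K _ (col_mx S Z) b isT K0 hK C0 (colL Z hZ).
exists q; rewrite -LE; apply: le_trans hq _.
rewrite ler_pdivrMr ?ltr0n//.
have -> : K ^+ 2 * ((4 + 4 * s ^+ 2) * r ^+ 2) = (K * r) ^+ 2 * (4 + 4 * s ^+ 2) by ring.
have x0 : 0 <= (K * r) ^+ 2 by rewrite sqr_ge0.
case: kK => kK _.
apply: le_trans (_ : (K * r) ^+ 2 * (4 + 4 / 6400) <= _).
  by apply: ler_wpM2l => //; lra.
lra.
Qed.
End Nets.

(** * The deterministic argument *)

Section Deterministic.
Context {R : realType}.

Lemma fnorm_le_entries (m n : nat) (A B : 'M[R]_(m, n)) :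
  (forall i j, `|A i j| <= `|B i j|) -> fnorm A <= fnorm B.
Proof.
move=> h; apply: ler_wsqrtr; apply: ler_sum => i _; apply: ler_sum => j _.
rewrite -[leLHS]real_normK ?num_real// -[leRHS]real_normK ?num_real//.
by apply: lerXn2r; rewrite ?nnegrE.
Qed.

Lemma fnorm_row_cols (m n : nat) (A : 'M[R]_(m, n)) :
  fnorm (\row_j fnorm (col j A)) = fnorm A.
Proof.
apply/eqP; rewrite -(@eqrXn2 _ 2) ?fnorm_ge0//; apply/eqP.
rewrite fnorm_sqr big_ord1 fnorm_sqr_cols.
by apply: eq_bigr => j _; rewrite mxE.
Qed.

Lemma fnorm_row_le_sum (n : nat) (v : 'rV[R]_n) : fnorm v <= \sum_j `|v 0 j|.
Proof.
rewrite {1}(row_sum_delta v); apply: le_trans (fnorm_sum _) _.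
apply: ler_sum => j _; rewrite fnormZ -[leRHS]mulr1; apply: ler_wpM2l => //.
rewrite -(@ler_pXn2r _ 2) ?nnegrE ?fnorm_ge0// fnorm_sqr big_ord1 expr1n.
rewrite (bigD1 j)//= mxE !eqxx expr1n big1 ?addr0// => k /negbTE kj.
by rewrite mxE kj andbF expr0n.
Qed.

Variables (n p : nat) (S : 'M[R]_p) (Z : 'M[R]_(n, p)) (r s t : R).
Hypotheses (r0 : 0 <= r) (s0 : 0 <= s) (t0 : 0 <= t).

(** Apply the vector inequality to all columns and take Euclidean norms.  The l1
    norms of the columns of B add up to its entrywise l1 norm, and the vector of the
    l1 norms of the columns of Th is the sum of the rows of |Th|. *)
Lemma matrix_of_vector_bound :
  (forall (b : 'cV[R]_p) (th : 'cV[R]_n),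
    24 / 100 * Num.max (fnorm (S *m b)) (fnorm th)
      - 36 * r * l1norm b * s - 33 * l1norm th * t <= fnorm (Z *m b - th)) ->
  forall (B : 'M[R]_p) (Th : 'M[R]_(n, p)),
    24 / 100 * Num.max (fnorm (S *m B)) (fnorm Th)
      - 36 * r * mixed_norm 1 1 B * s - 33 * mixed_norm 2 1 Th * t
    <= fnorm (Z *m B - Th).
Proof.
move=> hv B Th.
pose a : 'rV[R]_p := \row_j fnorm (col j (Z *m B - Th)).
pose be : 'rV[R]_p := \row_j l1norm (col j B).
pose ga : 'rV[R]_p := \row_j l1norm (col j Th).
have colM m (M : 'M[R]_(m, p)) j : col j (M *m B) = M *m col j B.
  by rewrite !colE mulmxA.
have hX (X : 'rV[R]_p) : (forall j, 0 <= X 0 j) ->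
    (forall j, X 0 j <= Num.max (fnorm (S *m col j B)) (fnorm (col j Th))) ->
    24 / 100 * fnorm X - 36 * r * mixed_norm 1 1 B * s - 33 * mixed_norm 2 1 Th * t
    <= fnorm (Z *m B - Th).
  move=> X0 hX.
  have hbe : fnorm be <= mixed_norm 1 1 B.
    apply: le_trans (fnorm_row_le_sum _) _; rewrite mixed_norm11E exchange_big /=.
    apply: ler_sum => j _; rewrite mxE ger0_norm ?l1norm_ge0//.
    by apply: ler_sum => i _; rewrite mxE.
  have hga : fnorm ga <= mixed_norm 2 1 Th.
    have -> : ga = \sum_i map_mx Num.norm (row i Th).
      apply/rowP => j; rewrite summxE mxE; apply: eq_bigr => i _; by rewrite !mxE.
    apply: le_trans (fnorm_sum _) _; rewrite mixed_norm21E; apply: ler_sum => i _.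
    by apply: fnorm_le_entries => k j; rewrite mxE normr_id.
  have key : 24 / 100 * fnorm X <= fnorm (a + (36 * r * s) *: be + (33 * t) *: ga).
    rewrite -[24 / 100](@ger0_norm R) -?fnormZ; last by lra.
    apply: fnorm_le_entries => i j; rewrite ord1 !mxE.
    have aj0 : 0 <= fnorm (col j (Z *m B - Th)) by exact: fnorm_ge0.
    rewrite !ger0_norm; first last.
    - by rewrite mulr_ge0//; lra.
    - by rewrite !addr_ge0// !mulr_ge0// ?l1norm_ge0.
    have := hv (col j B) (col j Th).
    have -> : Z *m col j B - col j Th = col j (Z *m B - Th).
      by rewrite -colM; apply/colP => k; rewrite !mxE.
    have := hX j; lra.
  have tri : fnorm (a + (36 * r * s) *: be + (33 * t) *: ga) <=
     fnorm a + 36 * r * s * fnorm be + 33 * t * fnorm ga.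
    apply: le_trans (fnormD _ _) _; rewrite fnormZ ger0_norm ?mulr_ge0// lerD2r.
    by apply: le_trans (fnormD _ _) _; rewrite fnormZ ger0_norm ?mulr_ge0.
  have aE : fnorm a = fnorm (Z *m B - Th) by rewrite /a fnorm_row_cols.
  have h1 : 36 * r * s * fnorm be <= 36 * r * s * mixed_norm 1 1 B.
    by apply: ler_wpM2l => //; rewrite !mulr_ge0.
  have h2 : 33 * t * fnorm ga <= 33 * t * mixed_norm 2 1 Th.
    by apply: ler_wpM2l => //; rewrite mulr_ge0.
  lra.
have hX1 := hX (\row_j fnorm (col j (S *m B))).
have hX2 := hX (\row_j fnorm (col j Th)).
rewrite !fnorm_row_cols in hX1 hX2.
case: (leP (fnorm (S *m B)) (fnorm Th)) => _.
  by apply: hX2 => j; rewrite mxE ?fnorm_ge0// le_max lexx orbT.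
apply: hX1 => j; rewrite mxE ?fnorm_ge0// colM le_max lexx//.
Qed.

Hypothesis hS : forall j, fnorm (col j S) <= r.
Hypothesis hZ : forall j, fnorm (col j Z) ^+ 2 <= (3 + 4 * s ^+ 2) * r ^+ 2.

(** By homogeneity the maximum is 1, and if one of the two l1 terms exceeds 0.24 then
    the left-hand side of the inequality is nonpositive. *)
Lemma scale_vector_bound :
  (forall (b : 'cV[R]_p) (th : 'cV[R]_n),
    Num.max (fnorm (S *m b)) (fnorm th) = 1 ->
    36 * r * l1norm b * s <= 24 / 100 -> 33 * l1norm th * t <= 24 / 100 ->
    24 / 100 - 36 * r * l1norm b * s <= fnorm (Z *m b - th)) ->
  forall (b : 'cV[R]_p) (th : 'cV[R]_n),
    24 / 100 * Num.max (fnorm (S *m b)) (fnorm th)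
      - 36 * r * l1norm b * s - 33 * l1norm th * t <= fnorm (Z *m b - th).
Proof.
move=> h b th; set M := Num.max _ _.
have M0 : 0 <= M by rewrite le_max fnorm_ge0.
have b0 : 0 <= 36 * r * l1norm b * s by rewrite !mulr_ge0 ?l1norm_ge0.
have th0 : 0 <= 33 * l1norm th * t by rewrite !mulr_ge0 ?l1norm_ge0.
have f0 := fnorm_ge0 (Z *m b - th).
have [?|hM] := lerP (24 / 100 * M) (36 * r * l1norm b * s + 33 * l1norm th * t).
  by lra.
have Mp : 0 < M by lra.
have Mi : 0 < M^-1 by rewrite invr_gt0.
have l1Z q (u : 'cV[R]_q) : l1norm (M^-1 *: u) = M^-1 * l1norm u.
  rewrite /l1norm mulr_sumr; apply: eq_bigr => i _.
  by rewrite mxE normrM (gtr0_norm Mi).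
have := h (M^-1 *: b) (M^-1 *: th).
rewrite -!scalemxAr -scalerBr !fnormZ !(gtr0_norm Mi) -maxr_pMr ?(ltW Mi)// -/M.
rewrite mulVf ?gt_eqF// !l1Z => /(_ erefl).
rewrite (_ : 36 * r * (M^-1 * l1norm b) * s = (36 * r * l1norm b * s) / M); last by ring.
rewrite (_ : 33 * (M^-1 * l1norm th) * t = (33 * l1norm th * t) / M); last by ring.
rewrite !ler_pdivrMr// => /(_ ltac:(lra) ltac:(lra)).
rewrite ler_pdivlMl// mulrBr mulrC mulrCA divff ?gt_eqF// mulr1; lra.
Qed.

(** For s >= 1/80 the columns of Z have norm at most 150 s r, and
    r ||b||_1 <= 1 / (150 s) < 1, so ||S b|| < 1 and ||th|| = 1.  Then
    1 - 150 s r ||b||_1 is at least 0.24 - 36 s r ||b||_1. *)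
Lemma vector_bound_large_p : 1 / 80 <= s ->
  forall (b : 'cV[R]_p) (th : 'cV[R]_n),
    Num.max (fnorm (S *m b)) (fnorm th) = 1 ->
    36 * r * l1norm b * s <= 24 / 100 -> 33 * l1norm th * t <= 24 / 100 ->
    24 / 100 - 36 * r * l1norm b * s <= fnorm (Z *m b - th).
Proof.
move=> hs b th hmax hb _.
have x0 : 0 <= r * l1norm b by rewrite mulr_ge0 ?l1norm_ge0.
have Sb : fnorm (S *m b) <= r * l1norm b by exact: fnorm_mulmx_l1.
have Zb : fnorm (Z *m b) <= (150 * s * r) * l1norm b.
  apply: fnorm_mulmx_l1 => j; rewrite -(@ler_pXn2r _ 2) ?nnegrE ?fnorm_ge0 ?mulr_ge0//.
  apply: le_trans (hZ j) _; rewrite exprMn; apply: ler_wpM2r; first exact: sqr_ge0.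
  have : (1 / 80) ^+ 2 <= s ^+ 2 by apply: lerXn2r; rewrite ?nnegrE//; lra.
  rewrite exprMn; lra.
have xs : (r * l1norm b) * (1 / 80) <= r * l1norm b * s by apply: ler_wpM2l.
have th1 : fnorm th = 1.
  move: hmax; case: leP => // _ S1; lra.
have := fnormB th (Z *m b); rewrite -(fnormN (th - _)) opprB th1; lra.
Qed.

(** The errors are 0.11 for S b and Z b, and 0.05 for th.  At the net points the norm is at
    least (1 - 0.11) / 2, which leaves 0.445 - 0.16 = 0.285 >= 0.24. *)
Lemma vector_bound_net (N1 N2 : finType) (p1 : N1 -> 'cV[R]_p) (p2 : N2 -> 'cV[R]_n) :
  (forall b : 'cV[R]_p, fnorm (S *m b) <= 1 -> 36 * r * l1norm b * s <= 24 / 100 ->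
    exists i, fnorm (S *m (p1 i - b)) ^+ 2 + fnorm (Z *m (p1 i - b)) ^+ 2
       <= (11 / 100) ^+ 2) ->
  (forall th : 'cV[R]_n, 33 * l1norm th * t <= 24 / 100 ->
    exists i, fnorm (p2 i - th) <= 1 / 20) ->
  (forall i j, 1 / 2 * Num.max (fnorm (S *m p1 i)) (fnorm (p2 j))
     <= fnorm (Z *m p1 i - p2 j)) ->
  forall (b : 'cV[R]_p) (th : 'cV[R]_n),
    Num.max (fnorm (S *m b)) (fnorm th) = 1 ->
    36 * r * l1norm b * s <= 24 / 100 -> 33 * l1norm th * t <= 24 / 100 ->
    24 / 100 - 36 * r * l1norm b * s <= fnorm (Z *m b - th).
Proof.
move=> h1 h2 h12 b th hmax hb hth.
have b1 : fnorm (S *m b) <= 1 by rewrite -hmax le_max lexx.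
have [i hi] := h1 b b1 hb; have [j hj] := h2 th hth.
have sq_le (x y : R) : 0 <= x -> x ^+ 2 + y ^+ 2 <= (11 / 100) ^+ 2 -> x <= 11 / 100.
  move=> x0 h; rewrite -(@ler_pXn2r _ 2) ?nnegrE//.
  by apply: le_trans h; rewrite lerDl sqr_ge0.
have e1 : fnorm (S *m (p1 i - b)) <= 11 / 100 by apply: sq_le hi; exact: fnorm_ge0.
have e2 : fnorm (Z *m (p1 i - b)) <= 11 / 100.
  by apply: (sq_le _ (fnorm (S *m (p1 i - b)))); rewrite ?fnorm_ge0// addrC.
have g1 : fnorm (S *m b) - fnorm (S *m (p1 i - b)) <= fnorm (S *m p1 i).
  rewrite lerBlDr -(fnormN (S *m (p1 i - b))) -mulmxN opprB.
  by apply: le_trans (fnormD _ _); rewrite -mulmxDr addrC subrK.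
have g2 : fnorm th - fnorm (p2 j - th) <= fnorm (p2 j).
  rewrite lerBlDr -(fnormN (p2 j - th)) opprB.
  by apply: le_trans (fnormD _ _); rewrite addrC subrK.
have g3 : fnorm (Z *m p1 i - p2 j) <=
    fnorm (Z *m b - th) + fnorm (Z *m (p1 i - b)) + fnorm (p2 j - th).
  have -> : Z *m p1 i - p2 j = (Z *m b - th) + Z *m (p1 i - b) - (p2 j - th).
    rewrite mulmxBr; apply/matrixP => k l; rewrite !mxE; ring.
  by rewrite -(fnormN (p2 j - th)); apply: le_trans (fnormD _ _) _; rewrite lerD2r fnormD.
have g4 := h12 i j.
have g5 : 89 / 100 <= Num.max (fnorm (S *m p1 i)) (fnorm (p2 j)).
  rewrite le_max; apply/orP.
  by move: hmax; case: (leP (fnorm (S *m b)) (fnorm th)) => _ E;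
    [right|left]; lra.
have b0 : 0 <= 36 * r * l1norm b * s by rewrite !mulr_ge0 ?l1norm_ge0.
lra.
Qed.
End Deterministic.

(** * The covariance seminorm *)

Section Covariance.
Context {R : realType}.

Lemma fnorm_rescale_sqr (n p : nat) (A : 'M[R]_(n, p)) : (0 < n)%N ->
  n%:R * fnorm (rescale A) ^+ 2 = fnorm A ^+ 2.
Proof.
move=> n0; rewrite /rescale fnormZ exprMn real_normK ?num_real// exprVn.
by rewrite sqr_sqrtr ?ler0n// mulrA divff ?mul1r// pnatr_eq0 -lt0n.
Qed.

Lemma psdmxD (p : nat) (A B : 'M[R]_p) : psdmx A -> psdmx B -> psdmx (A + B).
Proof.
move=> [sA A0] [sB B0]; split; first by rewrite linearD /= sA sB.
by move=> u; rewrite mulmxDr mulmxDl mxE addr_ge0.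
Qed.

Lemma unitmx_kernel (p : nat) (A : 'M[R]_p) :
  (forall u : 'rV_p, u *m A = 0 -> u = 0) -> A \in unitmx.
Proof.
move=> hA; rewrite -row_free_unit -kermx_eq0; apply/eqP/row_matrixP => i.
by rewrite row0; apply: hA; rewrite -row_mul mulmx_ker row0.
Qed.

Lemma psd_add_unitmx (p : nat) (A B : 'M[R]_p) : psdmx A -> psdmx B ->
  A \in unitmx -> A + B \in unitmx.
Proof.
move=> /psd_dotr[sA A0] /psd_dotr[sB B0] uA; apply: unitmx_kernel => u.
rewrite mulmxDr => h.
have : dotr (u *m A) u + dotr (u *m B) u = 0 by rewrite -dotrDl h /dotr mul0mx mxE.
move/eqP; rewrite paddr_eq0// => /andP[/eqP uA0 _].
by rewrite -[u](mulmxK uA) (psd_isotropic sA A0 uA0) mul0mx.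
Qed.

Variables (p : nat) (V : 'M[R]_p).
Hypothesis psdV : psdmx V.
Let S := sqrtmx V.

Lemma quad_sqrtmx (b : 'cV[R]_p) : (b^T *m V *m b) 0 0 = fnorm (S *m b) ^+ 2.
Proof.
have [[sS _] SS] := sqrtmxP psdV; rewrite -/S in sS SS.
transitivity (((S *m b)^T *m (S *m b)) 0 0).
  by rewrite trmx_mul sS -SS !mulmxA.
rewrite mxE fnorm_sqr_col.
by apply: eq_bigr => i _; rewrite mxE expr2.
Qed.

Lemma fnorm_col_sqrtmx j : fnorm (col j S) ^+ 2 = V j j.
Proof.
rewrite colE -quad_sqrtmx -mulmxA -colE trmx_delta -rowE.
by rewrite !mxE.
Qed.

Lemma rho_ge0 : 0 <= rho V.
Proof. exact: sqrtr_ge0. Qed.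

Lemma rho_sqr : rho V ^+ 2 = \big[Num.max/0]_(j < p) V j j.
Proof. by rewrite sqr_sqrtr//; exact: bigmax_ge_id. Qed.

Lemma fnorm_col_sqrtmx_le j : fnorm (col j S) <= rho V.
Proof.
rewrite -(@ler_pXn2r _ 2) ?nnegrE ?fnorm_ge0 ?rho_ge0//.
rewrite fnorm_col_sqrtmx rho_sqr; exact: (le_bigmax _ (fun j => V j j)).
Qed.

Lemma fnorm_col_sqrtmx_dim1 : p = 1%N -> forall j, fnorm (col j S) = rho V.
Proof.
move=> p1 j; apply/eqP; rewrite -(@eqrXn2 _ 2) ?fnorm_ge0 ?rho_ge0//.
rewrite fnorm_col_sqrtmx rho_sqr (bigD1 j)//= big_pred0.
  by apply/eqP/esym/max_idPl; rewrite -fnorm_col_sqrtmx sqr_ge0.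
move=> k; apply/negbTE; rewrite negbK; apply/eqP/val_inj => /=.
move: (ltn_ord k) (ltn_ord j); rewrite {2 4}p1 !ltnS !leqn0.
by move=> /eqP -> /eqP ->.
Qed.
End Covariance.

(** * The exceptional events *)

Section GoodEvent.
Context {d : measure_display} {T : measurableType d} {R : realType}.
Variable P : probability T R.
Variables (n p : nat) (S1 S2 : 'M[R]_p) (Y E : T -> 'M[R]_(n, p)).
Hypotheses (gY : iid_gaussian_rows P S1 Y) (gE : iid_gaussian_rows P S2 E).
Hypotheses (ind : indep_mx P Y E) (psd1 : psdmx S1) (psd2 : psdmx S2).
Hypotheses (n0 : (0 < n)%N) (p0 : (0 < p)%N).
Let V := S1 + S2.
Let S := sqrtmx V.
Let r := rho V.
Let Z t := rescale (Y t + E t).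

(** The summand 4 s^2 r^2 = 4 (ln p / n) r^2 of the threshold compensates the number
    p of columns in the union bound. *)
Lemma columns_bounded : exists2 N : set T,
  measurable N /\ (P N <= (expR (- (n%:R / 4)))%:E)%E &
  forall t, ~ N t -> forall j, fnorm (col j (Z t)) ^+ 2 <=
    (3 + 4 * Num.sqrt (ln p%:R / n%:R) ^+ 2) * r ^+ 2.
Proof.
have psdV := psdmxD psd1 psd2.
pose e j : 'cV[R]_p := delta_mx j 0.
have nR : 0 < n%:R :> R by rewrite ltr0n.
have colE' t j : n%:R * fnorm (col j (Z t)) ^+ 2 =
    \sum_i (((Y t + E t) *m e j) i 0) ^+ 2.
  transitivity (fnorm ((Y t + E t) *m e j : 'cV[R]_n) ^+ 2); last first.
    by rewrite fnorm_sqr_col.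
  rewrite -[RHS]fnorm_rescale_sqr//; congr (_ * fnorm _ ^+ 2).
  by rewrite /Z /rescale colE scalemxAl.
have vE j : ((e j)^T *m V *m e j) 0 0 = fnorm (col j S) ^+ 2.
  by rewrite quad_sqrtmx// colE.
have vle j : ((e j)^T *m V *m e j) 0 0 <= r ^+ 2.
  rewrite vE; apply: lerXn2r; rewrite ?nnegrE ?fnorm_ge0 ?rho_ge0//.
  exact: fnorm_col_sqrtmx_le.
(* if r = 0 then all entries of Z vanish almost surely *)
have [r0|r0] := eqVneq r 0.
  pose A (ij : 'I_n * 'I_p) :=
    [set t | ((Y t + E t) *m e ij.2) ij.1 0 != 0].
  have mA ij : measurable (A ij).
    rewrite (_ : A ij = (fun t => ((Y t + E t) *m e ij.2) ij.1 0) @^-1` [set~ 0]).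
      rewrite -[X in measurable X]setTI.
      by apply: (measurable_mulmx_sum gY gE) => //; exact: measurableC.
    by apply/seteqP; split=> t /= /eqP.
  have PA ij : (P (A ij) <= (0 : R)%:E)%E.
    rewrite (degenerate_null gY gE psd1 psd2)// -/V; apply/eqP.
    have h := vle ij.2; rewrite r0 expr0n in h.
    by rewrite eq_le h vE sqr_ge0.
  have [mU PU] := union_bound mA PA.
  exists (\bigcup_(ij in [set: 'I_n * 'I_p]) A ij).
    split=> //; apply: le_trans PU _.
    by rewrite mulr0 lee_fin expR_ge0.
  move=> t Nt j; rewrite -(ler_pM2l nR) colE' r0 expr0n !mulr0 big1// => i _.
  apply/eqP; rewrite sqrf_eq0; apply/negPn/negP => h.
  by apply: Nt; exists (i, j).
have rp : 0 < r ^+ 2 by rewrite exprn_gt0// lt_def r0 rho_ge0.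
pose A j := [set t | n%:R * (3 * r ^+ 2) + 4 * ln p%:R * r ^+ 2 <=
  \sum_i (((Y t + E t) *m e j) i 0) ^+ 2].
have mA j : measurable (A j).
  rewrite -[X in measurable X]setTI.
  have := measurable_sum_sqr gY gE (e j) (fun=> 0).
  under eq_fun do under eq_bigr do rewrite addr0.
  move=> /(_ measurableT `[n%:R * (3 * r ^+ 2) + 4 * ln p%:R * r ^+ 2, +oo[%classic).
  move=> /(_ ltac:(exact: measurable_itv)).
  congr (measurable (_ `&` _)); apply/seteqP.
  by split=> t /=; rewrite in_itv /= andbT.
have PA j : (P (A j) <= (expR (- (n%:R / 4) - ln p%:R))%:E)%E.
  exact: (upper_tail gY gE ind psd1 psd2 (ln p%:R) rp (vle j)).
have [mU PU] := union_bound mA PA.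
exists (\bigcup_(j in [set: 'I_p]) A j).
  split=> //; apply: le_trans PU _.
  rewrite lee_fin card_ord -[X in X * _]lnK ?posrE ?ltr0n// -expRD.
  by rewrite addrC subrK.
move=> t Nt j; rewrite -(ler_pM2l nR) colE'.
have /negP : ~ A j t by move=> h; apply: Nt; exists j.
rewrite /A /= -ltNge => /ltW h; apply: le_trans h _.
rewrite sqr_sqrtr ?divr_ge0 ?ln_ge0 ?ler1n//.
by rewrite le_eqVlt; apply/orP; left; apply/eqP; field; rewrite gt_eqF.
Qed.

(** Union bound over the pairs of net points; [lower_tail] is applied with
    a = - sqrt n th and M = max(||S b||, ||th||)^2. *)
Lemma net_separated (N1 N2 : finType) (p1 : N1 -> 'cV[R]_p) (p2 : N2 -> 'cV[R]_n) :
  exists2 N : set T,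
  measurable N /\ (P N <= (#|N1|%:R * #|N2|%:R * expR (- (n%:R / 4)))%:E)%E &
  forall t, ~ N t -> forall i j, 1 / 2 * Num.max (fnorm (S *m p1 i)) (fnorm (p2 j))
     <= fnorm (Z t *m p1 i - p2 j).
Proof.
have psdV := psdmxD psd1 psd2.
have nR : 0 < n%:R :> R by rewrite ltr0n.
pose b (ij : N1 * N2) := p1 ij.1.
pose a (ij : N1 * N2) (k : 'I_n) := - (Num.sqrt n%:R * p2 ij.2 k 0).
pose M (ij : N1 * N2) := Num.max (fnorm (S *m p1 ij.1)) (fnorm (p2 ij.2)).
pose F ij t := \sum_k (((Y t + E t) *m b ij) k 0 + a ij k) ^+ 2.
have FE ij t : F ij t = n%:R * fnorm (Z t *m p1 ij.1 - p2 ij.2) ^+ 2.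
  rewrite fnorm_sqr_col mulr_sumr; apply: eq_bigr => k _.
  rewrite /Z /rescale -scalemxAl !mxE /a /b.
  rewrite -{2}(sqr_sqrtr (ler0n R n)) -exprMn; congr (_ ^+ 2).
  by rewrite mulrBr mulrA divff ?mul1r// gt_eqF// sqrtr_gt0.
pose A ij := [set t | F ij t < n%:R * M ij ^+ 2 / 4].
have mA ij : measurable (A ij).
  rewrite -[X in measurable X]setTI.
  have := measurable_sum_sqr gY gE (b ij) (a ij).
  move=> /(_ measurableT `]-oo, (n%:R * M ij ^+ 2 / 4)[%classic).
  move=> /(_ ltac:(exact: measurable_itv)).
  by congr (measurable (_ `&` _)); apply/seteqP; split=> t /=; rewrite in_itv.
have M0 ij : 0 <= M ij by rewrite le_max fnorm_ge0.
have PA ij : (P (A ij) <= (expR (- (n%:R / 4)))%:E)%E.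
  have [Mz|Mnz] := eqVneq (M ij) 0.
    rewrite (_ : A ij = set0) ?measure0 ?lee_fin ?expR_ge0//.
    rewrite -subset0 => t; rewrite /A /= Mz expr0n mulr0 mul0r FE.
    by rewrite ltNge mulr_ge0 ?sqr_ge0// ltW.
  have Mp : 0 < M ij ^+ 2 by rewrite exprn_gt0// lt_def Mnz M0.
  have vE : ((b ij)^T *m V *m b ij) 0 0 = fnorm (S *m p1 ij.1) ^+ 2.
    by rewrite quad_sqrtmx.
  have aE : \sum_k a ij k ^+ 2 = n%:R * fnorm (p2 ij.2) ^+ 2.
    rewrite fnorm_sqr_col mulr_sumr; apply: eq_bigr => k _.
    by rewrite /a sqrrN exprMn sqr_sqrtr// ler0n.
  have sq_mono (x y : R) : 0 <= x -> x <= y -> x ^+ 2 <= y ^+ 2.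
    by move=> x0 xy; apply: lerXn2r; rewrite ?nnegrE// (le_trans x0).
  apply: le_trans (@lower_tail _ _ _ P n p S1 S2 Y E gY gE ind psd1 psd2
    (b ij) (a ij) (M ij ^+ 2) n0 Mp _ _ _).
  - apply: le_measure; rewrite ?inE//; last by move=> t /= /ltW.
    rewrite -[X in measurable X]setTI.
    have := measurable_sum_sqr gY gE (b ij) (a ij).
    move=> /(_ measurableT `]-oo, (n%:R * M ij ^+ 2 / 4)]%classic).
    move=> /(_ ltac:(exact: measurable_itv)).
    by congr (measurable (_ `&` _)); apply/seteqP; split=> t /=; rewrite in_itv.
  - by rewrite -/V vE; apply: sq_mono; rewrite ?fnorm_ge0// le_max lexx.
  - rewrite aE ler_pM2l//; apply: sq_mono; rewrite ?fnorm_ge0//.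
    by rewrite le_max lexx orbT.
  - rewrite -/V vE aE /M; case: (leP (fnorm (S *m p1 ij.1)) (fnorm (p2 ij.2))) => _;
      by [right|left].
have [mU PU] := union_bound mA PA.
exists (\bigcup_(ij in [set: N1 * N2]) A ij).
  by split=> //; apply: le_trans PU _; rewrite card_prod natrM.
move=> t Nt i j.
have /negP : ~ A (i, j) t by move=> h; apply: Nt; exists (i, j).
rewrite /A /= -leNgt FE /= -mulrA ler_pM2l// => h.
rewrite -(@ler_pXn2r _ 2) ?nnegrE ?fnorm_ge0 ?mulr_ge0 ?(M0 (i, j))//.
by apply: le_trans h; rewrite exprMn /M /=; lra.
Qed.
End GoodEvent.

(** * The uniform lower bound *)

Section UniformBound.
Context {d : measure_display} {T : measurableType d} {R : realType}.
Variable P : probability T R.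

Lemma uniform_lower_bound (n p : nat) (hn : (208 <= n)%N) (hp : (1 <= p)%N)
    (S1 S2 : 'M[R]_p) (Y E : T -> 'M[R]_(n, p)) :
  iid_gaussian_rows P S1 Y -> iid_gaussian_rows P S2 E -> indep_mx P Y E ->
  psdmx S1 -> psdmx S2 ->
  with_prob_ge P (1 - 2 * expR (- (n%:R / 297))) (fun t =>
    forall (B : 'M[R]_p) (Th : 'M[R]_(n, p)),
    24 / 100 * Num.max (fnorm (sqrtmx (S1 + S2) *m B)) (fnorm Th)
      - 36 * rho (S1 + S2) * mixed_norm 1 1 B * Num.sqrt (ln p%:R / n%:R)
      - 33 * mixed_norm 2 1 Th * Num.sqrt (ln n%:R / n%:R)
    <= fnorm (rescale (Y t + E t) *m B - Th)).
Proof.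
move=> gY gE ind psd1 psd2.
have psdV := psdmxD psd1 psd2.
have n0 : (0 < n)%N by apply: leq_trans hn.
have nR := @n_ge R n hn.
set s := Num.sqrt (ln p%:R / n%:R); set t0 := Num.sqrt (ln n%:R / n%:R).
set S := sqrtmx (S1 + S2); set r := rho (S1 + S2).
have hS j : fnorm (col j S) <= r by exact: fnorm_col_sqrtmx_le.
have r0 : 0 <= r by exact: rho_ge0.
have s0 : 0 <= s by exact: sqrtr_ge0.
have tp : 0 <= t0 by exact: sqrtr_ge0.
have [NC [mNC PNC] hNC] := columns_bounded gY gE ind psd1 psd2 n0 hp.
have [NS mNS [PNS hNS]] : exists2 NS : set T, measurable NS &
    (P NS <= (expR (- (n%:R / 297)))%:E)%E /\
    forall w, ~ (NC `|` NS) w -> forall (b : 'cV[R]_p) (th : 'cV[R]_n),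
    Num.max (fnorm (S *m b)) (fnorm th) = 1 ->
    36 * r * l1norm b * s <= 24 / 100 -> 33 * l1norm th * t0 <= 24 / 100 ->
    24 / 100 - 36 * r * l1norm b * s <= fnorm (rescale (Y w + E w) *m b - th).
  (* for s > 1/80 the bound on the columns suffices, without any net *)
  have [hs|hs] := lerP s (1 / 80); last first.
    exists set0 => //; split; first by rewrite measure0 lee_fin expR_ge0.
    move=> w; rewrite setU0 => /hNC hw.
    by apply: vector_bound_large_p => //; exact: ltW.
  have [N1 [p1 [cN1 hp1]]] := coefficient_net hn hp r0 hS (fnorm_col_sqrtmx_dim1 psdV) hs.
  have [N2 [p2 [cN2 hp2]]] := @response_net R n hn.
  have [NS [mNS PNS] hNS] := net_separated gY gE ind psd1 psd2 n0 p1 p2.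
  exists NS => //; split.
    apply: le_trans PNS _; rewrite lee_fin.
    apply: le_trans (_ : expR (6 / 100 * n%:R) * expR (18 / 100 * n%:R)
      * expR (- (n%:R / 4)) <= _).
      by apply: ler_wpM2r; [exact: expR_ge0|apply: ler_pM].
    by rewrite -!expRD ler_expR; lra.
  move=> w /not_orP[/hNC hC /hNS hw].
  by apply: (@vector_bound_net _ n p S _ r s t0 r0 s0 N1 N2 p1 p2) => //; exact: hp1.
exists (~` (NC `|` NS)); split.
- by apply: measurableC; exact: measurableU.
- rewrite probability_setC; last exact: measurableU.
  rewrite EFinB; apply: leeB => //.
  apply: le_trans (measureU2 _ mNC mNS) _.
  apply: le_trans (leeD PNC PNS) _.
  rewrite -EFinD lee_fin.
  have : expR (- (n%:R / 4)) <= expR (- (n%:R / 297)) :> R by rewrite ler_expR; lra.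
  lra.
- move=> w hw; apply: matrix_of_vector_bound => //.
  by apply: scale_vector_bound => //; exact: hNS.
Qed.
End UniformBound.

Theorem theorem2 (R : realType) (d : measure_display) (T : measurableType d)
    (P : probability T R) (n p : nat) (hn : (208 <= n)%N) (hp : (1 <= p)%N)
    (Sigma SigmaE : 'M[R]_p) (X Y ED ER : T -> 'M[R]_(n, p))
    (hmodel : contamination_model P Sigma SigmaE X Y ED ER) :
  let SigmaS := Sigma + SigmaE in
  with_prob_ge P (1 - 2 * expR (- (n%:R / 297))) (fun t =>
    forall (B : 'M[R]_p) (Theta : 'M[R]_(n, p)),
      mixed_norm 2 2 (rescale (X t) *m B - Theta) >=
        (24 / 100 - spectral_norm (rescale (ED t) *m mpinvmx (sqrtmx SigmaS)))
          * Num.max (mixed_norm 2 2 (sqrtmx SigmaS *m B))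
                    (mixed_norm 2 2 Theta)
        - 36 * rho SigmaS * mixed_norm 1 1 B * Num.sqrt (ln p%:R / n%:R)
        - 33 * mixed_norm 2 1 Theta * Num.sqrt (ln n%:R / n%:R)).
Proof.
move: hmodel => [[psd1 psd2] XE [gY gE] ind hED] SS.
have [A [mA PA hA]] := uniform_lower_bound hn hp gY gE ind psd1 psd2.
exists A; split=> // t /hA {}hA B Th.
rewrite !mixed_norm22E; have := hA B Th; rewrite -/SS.
set S := sqrtmx SS; set M := Num.max _ _; set sn := spectral_norm _.
set F := rescale (ED t); have -> : rescale (X t) *m B - Th =
    (rescale (Y t + ER t) *m B - Th) + F *m B.
  rewrite XE /F /rescale addrAC -mulmxDl -scalerDr.
  by congr (_ *: _ *m _ - _); rewrite -addrA [ER t + _]addrC.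
have [sn0 _] := @spectral_norm_bound _ _ _ p (F *m mpinvmx S) (S *m B) hp.
rewrite -/sn in sn0.
have hF : fnorm (F *m B) <= sn * M.
  apply: (@le_trans _ _ (sn * fnorm (S *m B))); last first.
    by apply: ler_wpM2l => //; rewrite le_max lexx.
  have [E0|En0] := eqVneq (ED t) 0.
    by rewrite /F E0 /rescale scaler0 mul0mx fnorm0 mulr_ge0 ?fnorm_ge0.
  have uS : S \in unitmx.
    have uSS : SS \in unitmx.
      by apply: psd_add_unitmx => //; apply: hED; exists t.
    have [_ SE] := sqrtmxP (psdmxD psd1 psd2).
    by move: uSS; rewrite -[SS]SE unitmx_mul => /andP[].
  have [_] := @spectral_norm_bound _ _ _ p (F *m mpinvmx S) (S *m B) hp.
  by rewrite -/sn mulmxA -[F *m _ *m S]mulmxA mpinvmx_unit// mulmx1.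
have := fnormB (rescale (Y t + ER t) *m B - Th) (- (F *m B)).
rewrite opprK fnormN => h1 h2.
rewrite mulrBl; lra.
Qed.
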